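(* Let $\varepsilon\in\{1,-1\}$ and $\Gamma\in\mathbb{R}_+$, and let $K$ be the inviscid matrix kernel (depending on $\varepsilon,\Gamma$) defined in the context. Consider the spectral condition $$\det\left(I+\mathcal{L}K(\lambda)\right)\neq0\quad\text{for all }\lambda\in\mathbb{C}\text{ with }\operatorname{Re}\lambda\ge0.\qquad(\ast)$$ 1. If $\varepsilon=1$, then $(\ast)$ is satisfied for all $\Gamma\in\mathbb{R}_+$. 2. If $\varepsilon=-1$, then $(\ast)$ is satisfied if and only if $\Gamma<\Gamma_c$, where $$\frac{1}{\Gamma_c}=\frac{3\pi}{4}\,b_c^2(1-b_c^2).$$
   Context: Let $e=(0,0,1)\in\mathbb{S}^2$ and $\mathbb{P}_{e^\perp}=\mathrm{I}-e\otimes e$. For a function $\psi$ on $\mathbb{S}^2$ set $u[\psi]=i\,\mathbb{P}_{e^\perp}\sigma e$ with $\sigma=\varepsilon\int_{\mathbb{S}^2}\psi(p)\,p\otimes p\,dp$, and let $\bar L_2(p)=\frac{3i\Gamma}{4\pi}(p\cdot e)\,\mathbb{P}_{e^\perp}p$. With $\nu=0$, $L_1=-i\,e\cdot p$ (a multiplication operator), so $(e^{tL_1}\phi)(p)=e^{-i(e\cdot p)t}\phi(p)$. The kernel $K:\mathbb{R}_+\to M_3(\mathbb{C})$ is defined by $K(t)v=-u[e^{tL_1}(\bar L_2\cdot v)]$ for $v\in\mathbb{C}^3$, where $a\cdot b=\sum_ja_jb_j$; it is integrable on $\mathbb{R}_+$. $\mathcal{L}K(\lambda)=\int_0^{+\infty}e^{-\lambda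 t}K(t)\,dt$. The number $b_c\in(0,1)$ ($b_c\approx0.62375$) is the unique zero in $(0,1)$ of the function $b\mapsto\mathrm{PV}\int_{-1}^1\frac{z^2(1-z^2)}{b+z}\,dz=2b^3-\frac43b+(b^4-b^2)\ln\frac{1-b}{1+b}$ (which is negative on $(0,b_c)$ and positive on $(b_c,1)$). *)

(* Defs.v *)
From HB Require Import structures.
From mathcomp Require Import all_boot all_order all_algebra.
From mathcomp Require Import all_classical all_reals all_analysis.
From mathcomp Require Import complex.

Set Implicit Arguments.
Unset Strict Implicit.
Unset Printing Implicit Defensive.

Import Order.TTheory GRing.Theory Num.Theory.
Import numFieldNormedType.Exports.

Local Open Scope classical_set_scope.
Local Open Scope ring_scope.
Local Open Scope complex_scope.

Section ComplexAnalysis.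
Variable R : realType.

Definition Cexp (z : R[i]) : R[i] :=
  (expR (complex.Re z))%:C * (cos (complex.Im z) +i* sin (complex.Im z)).

Definition Cintegral d (T : measurableType d)
    (mu : {measure set T -> \bar R}) (D : set T) (f : T -> R[i]) : R[i] :=
  (\int[mu]_(x in D) complex.Re (f x)) +i* (\int[mu]_(x in D) complex.Im (f x)).

Definition laplace n (K : R -> 'M[R[i]]_n) (lambda : R[i]) : 'M[R[i]]_n :=
  \matrix_(i, j) Cintegral lebesgue_measure `[0, +oo[
    (fun t => Cexp (- lambda * t%:C) * K t i j).

(* l = PV \int_a^b f(z) dz for f singular at c *)
Definition is_PV (f : R -> R) (a b c l : R) : Prop :=
  (\int[lebesgue_measure]_(z in `[a, b] `\` `]c - eta, c + eta[) f z)
    @[eta --> 0^'+] --> l.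

End ComplexAnalysis.

Section Sphere.
Variable R : realType.

(* x = (theta, phi): colatitude and longitude *)
Definition sphere_point (x : R * R) : 'cV[R]_3 :=
  \col_i [:: sin x.1 * cos x.2; sin x.1 * sin x.2; cos x.1]`_i.

(* Functions on S^2 are represented by functions on R^3, of which only the
   values on S^2 matter; sin theta is the density of the surface measure in
   spherical coordinates. *)
Definition sphere_integral (f : 'cV[R]_3 -> R[i]) : R[i] :=
  Cintegral (lebesgue_measure \x lebesgue_measure)%E
    (`[0, pi] `*` `[0, 2 * pi])
    (fun x : R * R => (sin x.1)%:C * f (sphere_point x)).

End Sphere.

Section Kernel.
Variable R : realType.
Variables eps Gamma : R.
Local Notation C := R[i].
Implicit Types (p : 'cV[R]_3) (v : 'cV[C]_3) (psi phi : 'cV[R]_3 -> C).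

Definition toC3 p : 'cV[C]_3 := map_mx (real_complex R) p.

(* bilinear, without conjugation *)
Definition dot (v w : 'cV[C]_3) : C := \sum_j v j 0 * w j 0.

Definition tensor (v w : 'cV[C]_3) : 'M[C]_3 := v *m w^T.

Definition evec : 'cV[C]_3 := delta_mx ord_max 0.

Definition proj_e_perp : 'M[C]_3 := 1%:M - tensor evec evec.

Definition sigma psi : 'M[C]_3 :=
  eps%:C *: \matrix_(i, j)
    sphere_integral (fun p => psi p * tensor (toC3 p) (toC3 p) i j).

Definition u_of psi : 'cV[C]_3 := 'i%C *: (proj_e_perp *m sigma psi *m evec).

Definition L1 p : C := - 'i%C * dot evec (toC3 p).

Definition exp_tL1 (t : R) phi : 'cV[R]_3 -> C :=
  fun p => Cexp (t%:C * L1 p) * phi p.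

Definition L2bar p : 'cV[C]_3 :=
  (3 * 'i%C * Gamma%:C / (4 * pi%:C) * dot (toC3 p) evec)
    *: (proj_e_perp *m toC3 p).

Definition kernel_op (t : R) v : 'cV[C]_3 :=
  - u_of (exp_tL1 t (fun p => dot (L2bar p) v)).

(* the matrix of the linear map kernel_op t in the canonical basis of C^3 *)
Definition kernel (t : R) : 'M[C]_3 :=
  \matrix_(i, j) kernel_op t (delta_mx j 0) i 0.

Definition spectral_condition : Prop :=
  forall lambda : C, 0 <= complex.Re lambda ->
    \det (1%:M + laplace kernel lambda) != 0.

End Kernel.

Section Threshold.
Variable R : realType.

Definition b_c : R :=
  xget 0 [set b : R | 0 < b < 1 /\
    is_PV (fun z => z ^+ 2 * (1 - z ^+ 2) / (b + z)) (- 1) 1 (- b) 0].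

Definition Gamma_c : R := (3 * pi / 4 * b_c ^+ 2 * (1 - b_c ^+ 2))^-1.

End Threshold.

(* Main.v *)
(** In the variable [z = p . e] the kernel is [3 eps Gamma / 4 * k t] times the
    projection, with [k t] the integral over [[-1, 1]] of [cos (z t) w z] and
    [w z = z^2 (1 - z^2)]. Hence the determinant is
    [(1 + 3 eps Gamma / 4 * L l)^2], where [L] is the Laplace transform of [k],
    that is [L l = \int w z / (l + i z) dz] for [Re l > 0]. Since [k] decays
    quadratically, [L] extends continuously to the closed half-plane, and
    [Re L >= 0] settles the case [eps = 1].

    If [eps = - 1], the question is which reals [s > 0] are values of [L] for
    [Re l >= 0]. On the imaginary axis [L (i y) = pi w y - i PV y] for
    [|y| < 1] and [Im L (i y) <> 0] for [|y| >= 1], so the only positive real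
    value taken there is [M = pi w b_c]. Let [S] be the set of the positive
    reals [s <> M] that [L] attains for [Re l > 0]. By the minimum modulus
    principle applied to [L - s], any [s] that is closer to some value [L l]
    than to [L (i R)] and to [0] is attained. So [S] is a union of connected
    components of the positive reals deprived of [M]. It contains arbitrarily
    small reals, because [L] is positive on the positive reals and tends to 0
    at infinity, and it is bounded. Hence [S] is the interval from 0 to [M]. *)

Require Import Defs.
From mathcomp Require Import all_boot all_order all_algebra.
From mathcomp Require Import all_classical all_reals all_analysis.
From mathcomp Require Import measurable_realfun complex ring lra.

Set Implicit Arguments.
Unset Strict Implicit.
Unset Printing Implicit Defensive.

Import Order.TTheory GRing.Theory Num.Theory.
Import numFieldNormedType.Exports.

Local Open Scope classical_set_scope.
Local Open Scope ring_scope.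
Import Normc.

(** Holomorphy enters through second-order Taylor expansions with cubic remainder. The mean of 1/f
    over l + r, l - r, l + ir, l - ir is 1/f(l) up to O(r^3), whereas adding d |l|^2 to |1/f| raises
    the mean by d r^2. For small r this forbids an interior maximum, and letting d tend to 0 gives
    the minimum modulus principle for f.

    The value M has to be set apart because L - s then vanishes on the boundary, at i b_c, so that
    no positive distance to L(iR) is available. It is attained on the imaginary axis, which belongs
    to the region of the spectral condition: hence the strict inequality with [Gamma_c]. For eps =
    -1 the determinant vanishes where L = 4 / (3 Gamma), hence 1 / Gamma_c = 3 M / 4.

    The time integral defines L up to the axis, while explicit formulas are at hand for Re l > 0.
    Continuity connects the two: the boundary values are limits of closed forms, in which the
    complex logarithm of (l + i) / (l - i) splits into an argument, tending to pi for |y| < 1, and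
    the logarithm of the principal value. *)

Section DerivativeRules.
Context {R : realType}.
Implicit Types (f g : R -> R) (x a b c : R).

Lemma D_cst c x : is_derive x 1 (fun _ : R => c) 0.
Proof. exact: is_derive_cst. Qed.

Lemma D_id x : is_derive x 1 (fun z : R => z) 1.
Proof. exact: is_derive_id. Qed.

Lemma D_add f g x a b : is_derive x 1 f a -> is_derive x 1 g b ->
  is_derive x 1 (fun z => f z + g z) (a + b).
Proof. exact: is_deriveD. Qed.

Lemma D_opp f x a : is_derive x 1 f a -> is_derive x 1 (fun z => - f z) (- a).
Proof. exact: is_deriveN. Qed.

Lemma D_mul f g x a b : is_derive x 1 f a -> is_derive x 1 g b ->
  is_derive x 1 (fun z => f z * g z) (a * g x + f x * b).
Proof.
move=> fa gb; have := is_deriveM fa gb; rewrite /GRing.scale/= => h.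
by apply: (is_derive_eq h); ring.
Qed.

Lemma D_exp f n x a : is_derive x 1 f a ->
  is_derive x 1 (fun z => f z ^+ n) (n%:R * f x ^+ n.-1 * a).
Proof.
move=> fa; have h := is_deriveX n fa; rewrite exprfctE in h.
by apply: (is_derive_eq h); rewrite /GRing.scale.
Qed.

Lemma D_inv f x a : f x != 0 -> is_derive x 1 f a ->
  is_derive x 1 (fun z => (f z)^-1) (- a / f x ^+ 2).
Proof.
move=> fx0 fa; have h := is_deriveV fx0 fa.
by apply: (is_derive_eq h); rewrite /GRing.scale/=; ring.
Qed.

Lemma D_comp g f x a b : is_derive (f x) 1 g b -> is_derive x 1 f a ->
  is_derive x 1 (fun z => g (f z)) (b * a).
Proof. exact: is_derive1_comp. Qed.

Lemma D_expR f x a : is_derive x 1 f a ->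
  is_derive x 1 (fun z => expR (f z)) (expR (f x) * a).
Proof. by apply: (D_comp (g := expR)). Qed.

Lemma D_cos f x a : is_derive x 1 f a ->
  is_derive x 1 (fun z => cos (f z)) (- sin (f x) * a).
Proof. by apply: (D_comp (g := cos)). Qed.

Lemma D_sin f x a : is_derive x 1 f a ->
  is_derive x 1 (fun z => sin (f z)) (cos (f x) * a).
Proof. by apply: (D_comp (g := sin)). Qed.

Lemma D_atan f x a : is_derive x 1 f a ->
  is_derive x 1 (fun z => atan (f z)) ((1 + f x ^+ 2)^-1 * a).
Proof. by apply: (D_comp (g := atan)). Qed.

Lemma D_ln f x a : 0 < f x -> is_derive x 1 f a ->
  is_derive x 1 (fun z => ln (f z)) ((f x)^-1 * a).
Proof.
move=> fx0 fa; exact: (D_comp (is_derive1_ln fx0) fa).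
Qed.

Lemma D_sqrt f x a : 0 < f x -> is_derive x 1 f a ->
  is_derive x 1 (fun z => Num.sqrt (f z)) ((2 * Num.sqrt (f x))^-1 * a).
Proof. by move=> fx0 fa; exact: (D_comp (is_derive1_sqrt fx0) fa). Qed.

Lemma D_continuous f x a : is_derive x 1 f a -> {for x, continuous f}.
Proof.
move=> fa; apply: differentiable_continuous; apply/derivable1_diffP.
exact: ex_derive.
Qed.

End DerivativeRules.

(** Syntax-directed: the derivative is an existential variable that the rules fill in, and the rules
    for inverse, logarithm and square root leave their domain conditions as goals. *)
Ltac derive_rule := lazymatch goal with
  | |- is_derive _ _ (fun z => z) _ => eapply D_id
  | |- is_derive _ _ (fun _ => ?c) _ => eapply D_cst
  | |- is_derive _ _ (fun z => @?f z + @?g z) _ => eapply (@D_add _ f g);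
    derive_rule
  | |- is_derive _ _ (fun z => - @?f z) _ => eapply (@D_opp _ f); derive_rule
  | |- is_derive _ _ (fun z => @?f z * @?g z) _ => eapply (@D_mul _ f g);
    derive_rule
  | |- is_derive _ _ (fun z => @?f z ^+ ?n) _ => eapply (@D_exp _ f n); derive_rule
  | |- is_derive _ _ (fun z => (@?f z)^-1) _ => eapply (@D_inv _ f); [|derive_rule]
  | |- is_derive _ _ (fun z => expR (@?f z)) _ => eapply (@D_expR _ f); derive_rule
  | |- is_derive _ _ (fun z => cos (@?f z)) _ => eapply (@D_cos _ f); derive_rule
  | |- is_derive _ _ (fun z => sin (@?f z)) _ => eapply (@D_sin _ f); derive_rule
  | |- is_derive _ _ (fun z => atan (@?f z)) _ => eapply (@D_atan _ f); derive_rule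
  | |- is_derive _ _ (fun z => ln (@?f z)) _ => eapply (@D_ln _ f); [|derive_rule]
  | |- is_derive _ _ (fun z => Num.sqrt (@?f z)) _ => eapply (@D_sqrt _ f);
    [|derive_rule]
  end.

(* Unlike [is_derive] this is not a type class, so that lemmas with such
   premises can be used in [rewrite] and [apply] without instance search. *)
Definition has_derive {R : realType} (f : R -> R) (x a : R) : Prop :=
  is_derive x 1 f a.

(* leaves the equation on the derivative and the side conditions *)
Ltac derive := rewrite /has_derive; eapply is_derive_eq; [derive_rule|].

Ltac cont := let x := fresh "x" in move=> x; eapply D_continuous; derive_rule.

(** * Integrals over segments, product spaces and the half-line *)

Section RealIntegrals.
Context {R : realType}.
Notation mu := (@lebesgue_measure R).
Implicit Types (f g F : R -> R) (a b : R).

Lemma continuous_itv_integrable f a b : {in `[a, b], continuous f} ->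
  mu.-integrable `[a, b] (EFin \o f).
Proof.
move=> cf; apply: continuous_compact_integrable; first exact: segment_compact.
by apply: continuous_in_subspaceT => x /[!inE] xab; apply: cf.
Qed.

Lemma Rintegral_FTC f F a b : a <= b -> {in `[a, b], continuous f} ->
  (forall x, x \in `[a, b] -> has_derive F x (f x)) ->
  \int[mu]_(x in `[a, b]) f x = F b - F a.
Proof.
rewrite le_eqVlt => /predU1P[<- _ _|ab cf dF].
  by rewrite set_itv1 Rintegral_set1 subrr.
rewrite /Rintegral (@continuous_FTC2 _ f F)//.
- by apply: continuous_in_subspaceT => x /[!inE] xab; apply: cf.
- split.
  + move=> x /subset_itv_oo_cc xab; have := dF x xab; rewrite /has_derive => h;
    exact: ex_derive.
  + apply: cvg_at_right_filter; apply: (@D_continuous _ _ _ (f a)).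
    by apply: dF; rewrite in_itv/= lexx ltW.
  + apply: cvg_at_left_filter; apply: (@D_continuous _ _ _ (f b)).
    by apply: dF; rewrite in_itv/= lexx ltW.
- move=> x /subset_itv_oo_cc xab; rewrite derive1E; have := dF x xab => h.
  exact: derive_val.
Qed.

End RealIntegrals.

Section Fubini.
Context d1 d2 (T1 : measurableType d1) (T2 : measurableType d2) (R : realType).
Context (m1 : {sigma_finite_measure set T1 -> \bar R}).
Context (m2 : {sigma_finite_measure set T2 -> \bar R}).
Implicit Types (f : T1 * T2 -> R) (g : T1 -> R) (h : T2 -> R).
Implicit Types (A : set T1) (B : set T2).

(** By Tonelli, the domination bounds the integral of |f| by the product of the integrals of |g| and
    |h|; so f is integrable for the product measure and both orders of integration agree with it. *)
Let Rintegral_fubiniT f g h : measurable_fun [set: T1 * T2] f ->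
  m1.-integrable setT (EFin \o g) -> m2.-integrable setT (EFin \o h) ->
  (forall x y, `|f (x, y)| <= `|g x| * `|h y|) ->
  \int[(m1 \x m2)%E]_p f p = \int[m1]_x \int[m2]_y f (x, y) /\
  \int[(m1 \x m2)%E]_p f p = \int[m2]_y \int[m1]_x f (x, y).
Proof.
move=> mf ig ih fgh.
have mfE : measurable_fun [set: T1 * T2] (EFin \o f) by exact/measurable_EFinP.
have ig' := integrable_norm ig; have ih' := integrable_norm ih.
have fx x : m2.-integrable setT (fun y => (f (x, y))%:E).
  apply: le_integrable (integrableZl _ `|g x| ih') => //.
    exact/measurable_EFinP/(measurableT_comp mf).
  by move=> y _ /=; rewrite lee_fin normrM !normr_id.
have fy y : m1.-integrable setT (fun x => (f (x, y))%:E).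
  apply: le_integrable (integrableZl _ `|h y| ig') => //.
    exact/measurable_EFinP/(measurableT_comp mf).
  by move=> x _ /=; rewrite lee_fin normrM !normr_id mulrC.
have iF : (m1 \x m2)%E.-integrable setT (EFin \o f).
  apply/integrable12ltyP => //.
  pose I := (\int[m2]_y `|h y|%:E)%E.
  have Ifin : I \is a fin_num by exact: integrable_fin_num.
  apply: (@le_lt_trans _ _ (\int[m1]_x (`|g x|%:E * I))%E).
    apply: ge0_le_integral => //.
    - by move=> x _; apply: integral_ge0.
    - apply: (measurable_fun_fubini_tonelli_F (abse \o (EFin \o f))) => //=.
      exact: measurableT_comp.
    - by apply: emeasurable_funM => //; exact: measurable_int ig'.
    - move=> x _; rewrite /I -ge0_integralZl//.
      + apply: ge0_le_integral => //.
        * by apply: measurableT_comp => //; exact: measurable_int (fx x).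
        * by apply: emeasurable_funM => //; exact: measurable_int ih'.
        * by move=> y _; rewrite /= lee_fin.
      + exact: measurable_int ih'.
  rewrite -(fineK Ifin) ge0_integralZr//.
  - rewrite lte_mul_pinfty//; first exact: integral_ge0.
    + exact: integrable_fin_num.
    + exact: ltry.
  - exact: measurable_int ig'.
  - by rewrite lee_fin fine_ge0// integral_ge0.
split; rewrite /Rintegral.
  rewrite -(integral12_prod_meas1 iF); congr fine; apply: eq_integral => x _.
  by rewrite /fubini_F /= fineK//; exact: integrable_fin_num.
rewrite -(integral21_prod_meas1 iF); congr fine; apply: eq_integral => y _.
by rewrite /fubini_G /= fineK//; exact: integrable_fin_num.
Qed.

(** Extension by zero reduces this to the full spaces: for x outside A, or y outside B, the inner
    integrand is identically zero. *)
Lemma Rintegral_fubini A B f g h : measurable A -> measurable B ->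
  measurable_fun [set: T1 * T2] f ->
  m1.-integrable A (EFin \o g) -> m2.-integrable B (EFin \o h) ->
  (forall x y, A x -> B y -> `|f (x, y)| <= g x * h y) ->
  \int[(m1 \x m2)%E]_(p in A `*` B) f p =
    \int[m1]_(x in A) \int[m2]_(y in B) f (x, y) /\
  \int[(m1 \x m2)%E]_(p in A `*` B) f p =
    \int[m2]_(y in B) \int[m1]_(x in A) f (x, y).
Proof.
move=> mA mB mf ig ih fgh.
have mAB : measurable (A `*` B) by exact: measurableX.
have [] := @Rintegral_fubiniT (f \_ (A `*` B)) (g \_ A) (h \_ B).
- apply: (measurable_restrictT f mAB).1; exact: measurable_funTS mf.
- by rewrite -restrict_EFin; exact: (integrable_mkcond _ mA).1.
- by rewrite -restrict_EFin; exact: (integrable_mkcond _ mB).1.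
- move=> x y; rewrite !patchE; case: ifPn => [|_]; last first.
    by rewrite normr0 mulr_ge0.
  rewrite inE => -[/= Ax By]; rewrite !mem_set// -normrM.
  exact: le_trans (fgh _ _ Ax By) (ler_norm _).
move=> E1 E2; rewrite !(Rintegral_mkcond _ (A `*` B)).
split; [rewrite E1 {E1 E2}|rewrite E2 {E1 E2}].
  rewrite [RHS]Rintegral_mkcond; apply: eq_Rintegral => x _.
  rewrite patchE; case: ifPn => xA.
    rewrite [RHS]Rintegral_mkcond; apply: eq_Rintegral => y _.
    rewrite !patchE; congr (if _ then _ else _).
    by apply/idP/idP => [/set_mem[]//= _ By|By]; apply/mem_set => //;
      split => //=; exact/set_mem.
  rewrite (_ : (fun y => _) = cst 0) ?Rintegral_cst ?mul0r//.
  apply/funext => y; rewrite patchE ifN//; apply: contra xA => /set_mem[/= Ax _].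
  exact/mem_set.
rewrite [RHS]Rintegral_mkcond; apply: eq_Rintegral => y _.
rewrite patchE; case: ifPn => yB.
  rewrite [RHS]Rintegral_mkcond; apply: eq_Rintegral => x _.
  rewrite !patchE; congr (if _ then _ else _).
  by apply/idP/idP => [/set_mem[]//= Ax _|Ax]; apply/mem_set => //; split => //=;
    exact/set_mem.
rewrite (_ : (fun x => _) = cst 0) ?Rintegral_cst ?mul0r//.
apply/funext => x; rewrite patchE ifN//; apply: contra yB => /set_mem[/= _ By].
exact/mem_set.
Qed.

End Fubini.

Section HalfLine.
Context {R : realType}.
Notation mu := (@lebesgue_measure R).
Implicit Types (f g F G : R -> R) (l m : R).
Local Notation Ry := (`[0 : R, +oo[%classic).

Lemma within_continuous_itvy f : (forall t : R, 0 <= t -> {for t, continuous f}) ->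
  {within Ry, continuous f}.
Proof.
move=> cf; apply: continuous_in_subspaceT => t.
by rewrite inE/= in_itv/= andbT; exact: cf.
Qed.

Lemma continuous_itvy_measurable f :
  (forall t : R, 0 <= t -> {for t, continuous f}) -> measurable_fun Ry f.
Proof.
move=> cf; apply: subspace_continuous_measurable_fun => //.
exact: within_continuous_itvy.
Qed.

Lemma dominated_itvy_integrable f g :
  (forall t : R, 0 <= t -> {for t, continuous f}) ->
  (forall t : R, 0 <= t -> `|f t| <= g t) ->
  mu.-integrable Ry (EFin \o g) -> mu.-integrable Ry (EFin \o f).
Proof.
move=> cf fg; apply: le_integrable => //.
  by apply/measurable_EFinP; exact: (continuous_itvy_measurable cf).
move=> t; rewrite /= in_itv/= andbT => t0; rewrite lee_fin.
exact: le_trans (fg _ t0) (ler_norm _).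
Qed.

Let ge0_FTCy f F l :
  (forall t : R, 0 <= t -> {for t, continuous f}) ->
  (forall t : R, 0 <= t -> has_derive F t (f t)) ->
  (forall t : R, 0 <= t -> 0 <= f t) -> F t @[t --> +oo%R] --> l ->
  (\int[mu]_(t in Ry) (f t)%:E = l%:E - (F 0)%:E)%E.
Proof.
move=> cf dF f0 Fl; apply: ge0_continuous_FTC2y => //.
- exact: within_continuous_itvy.
- move=> t t0; have h : is_derive t 1 F (f t) := dF _ (ltW t0). exact: ex_derive.
- by apply: cvg_at_right_filter; exact: (D_continuous (dF _ (lexx 0))).
- move=> t; rewrite in_itv/= andbT => t0; rewrite derive1E.
  by have h : is_derive t 1 F (f t) := dF _ (ltW t0); exact: derive_val.
Qed.

Lemma ge0_integrable_FTCy f F l :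
  (forall t : R, 0 <= t -> {for t, continuous f}) ->
  (forall t : R, 0 <= t -> has_derive F t (f t)) ->
  (forall t : R, 0 <= t -> 0 <= f t) -> F t @[t --> +oo%R] --> l ->
  mu.-integrable Ry (EFin \o f).
Proof.
move=> cf dF f0 Fl; apply/integrableP; split.
  by apply/measurable_EFinP; exact: (continuous_itvy_measurable cf).
rewrite [ltLHS](_ : _ = \int[mu]_(t in Ry) (f t)%:E)%E; last first.
  apply: eq_integral => t; rewrite inE/= in_itv/= andbT => t0.
  by rewrite ger0_norm// f0.
by rewrite (ge0_FTCy cf dF f0 Fl) -EFinB ltry.
Qed.

(** The improper fundamental theorem is available for nonnegative integrands. Since |f| <= g, it
    applies to g and to f + g, and the difference gives f. *)
Lemma dominated_FTCy f F g G l m :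
  (forall t : R, 0 <= t -> {for t, continuous f}) ->
  (forall t : R, 0 <= t -> has_derive F t (f t)) -> F t @[t --> +oo%R] --> l ->
  (forall t : R, 0 <= t -> {for t, continuous g}) ->
  (forall t : R, 0 <= t -> has_derive G t (g t)) -> G t @[t --> +oo%R] --> m ->
  (forall t : R, 0 <= t -> `|f t| <= g t) ->
  \int[mu]_(t in Ry) f t = l - F 0.
Proof.
move=> cf dF Fl cg dG Gm fg.
have g0 t : 0 <= t -> 0 <= g t by move=> /fg; apply: le_trans.
have ig := ge0_integrable_FTCy cg dG g0 Gm.
have if_ := dominated_itvy_integrable cf fg ig.
have gE : \int[mu]_(t in Ry) g t = m - G 0 by rewrite /Rintegral (ge0_FTCy cg dG
  g0 Gm).
have fgE : \int[mu]_(t in Ry) (f t + g t) = l + m - (F 0 + G 0).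
  have -> // : l + m - (F 0 + G 0) = fine ((l + m)%:E - (F 0 + G 0)%:E) by [].
  congr fine; apply: (@ge0_FTCy (fun t => f t + g t) (fun t => F t + G t)).
  - by move=> t t0; apply: cvgD; [exact: cf|exact: cg].
  - by move=> t t0; apply: D_add; [exact: dF|exact: dG].
  - by move=> t t0; have := fg _ t0; rewrite ler_norml => /andP[]; lra.
  - exact: cvgD.
rewrite RintegralD// gE in fgE; apply: (addIr (m - G 0)); rewrite fgE; ring.
Qed.

Lemma cvgy_expRN (x : R) : 0 < x -> expR (- (x * t)) @[t --> +oo%R] --> (0 : R).
Proof.
move=> x0; apply: (@cvg_comp _ _ _ (fun t => x * t) (fun t => expR (- t)) _ +oo%R).
  exact: gt0_cvgMry x0 cvg_id.
exact: cvgr_expR.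
Qed.

End HalfLine.

(** * Lipschitz estimates and bounds of integrals *)

Section Bounds.
Context {R : realType}.
Notation mu := (@lebesgue_measure R).
Implicit Types (f : R -> R) (a b t x y z C : R).

Lemma derive_lipschitz f (df : R -> R) C :
  (forall x, has_derive f x (df x)) -> (forall x, `|df x| <= C) ->
  forall a b, `|f a - f b| <= C * `|a - b|.
Proof.
move=> fdf dfC a b; wlog ab : a b / b <= a => [hw|].
  case/orP: (le_total b a) => [ba|ab]; first exact: hw.
  by rewrite distrC (distrC a); exact: hw.
have [c _ ->] : exists2 c, c \in `[b, a]%R & f a - f b = df c * (a - b).
  apply: MVT_segment => // [x _|]; first exact: fdf.
  apply: continuous_subspaceT => x; exact: (D_continuous (fdf x)).
by rewrite normrM ler_wpM2r.
Qed.

Lemma cos_lipschitz a b : `|cos a - cos b| <= `|a - b|.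
Proof.
rewrite -[leRHS]mul1r; apply: (derive_lipschitz (df := fun x => - sin x)) => x.
  exact: is_derive_cos.
by rewrite normrN sin_max.
Qed.

Lemma sin_lipschitz a b : `|sin a - sin b| <= `|a - b|.
Proof.
rewrite -[leRHS]mul1r; apply: (derive_lipschitz (df := cos)) => x;
  first exact: is_derive_sin.
exact: cos_max.
Qed.

Lemma expRN_lipschitz a b : 0 <= a -> 0 <= b ->
  `|expR (- a) - expR (- b)| <= `|a - b|.
Proof.
wlog ab : a b / a <= b => [hw a0 b0|a0 b0].
  case/orP: (le_total a b) => [ab|ba]; first exact: hw.
  by rewrite distrC (distrC a); exact: hw.
have eab : expR (- b) <= expR (- a) by rewrite ler_expR lerN2.
rewrite ger0_norm ?subr_ge0// ler0_norm ?subr_le0//.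
have -> : expR (- a) - expR (- b) = expR (- a) * (1 - expR (- (b - a))).
  by rewrite mulrBr mulr1 -expRD; congr (_ - expR _); ring.
have h1 : expR (- a) <= 1 by rewrite -expR0 ler_expR oppr_le0.
have h2 := expR_ge1Dx (- (b - a)).
have h3 : expR (- (b - a)) <= 1 by rewrite -expR0 ler_expR oppr_le0 subr_ge0.
have h4 := expR_ge0 (- a).
apply: (@le_trans _ _ (1 * (1 - expR (- (b - a))))).
  by apply: ler_wpM2r => //; rewrite subr_ge0.
by rewrite mul1r; lra.
Qed.

Lemma expRN_le1 a : 0 <= a -> expR (- a) <= 1.
Proof. by move=> a0; rewrite -expR0 ler_expR oppr_le0. Qed.

Lemma Rintegral_le_bound f a b C : a <= b -> {in `[a, b], continuous f} ->
  (forall x, x \in `[a, b] -> `|f x| <= C) ->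
  `|\int[mu]_(x in `[a, b]) f x| <= C * (b - a).
Proof.
move=> ab cf fC; have fi := continuous_itv_integrable cf.
apply: le_trans (le_normr_Rintegral _ fi) _ => //.
have -> : C * (b - a) = \int[mu]_(x in `[a, b]) (cst C x).
  rewrite Rintegral_cst//= lebesgue_measure_itv/= lte_fin.
  by case: ltrP => [//|ba]; rewrite (_ : b = a) ?subrr//; apply/le_anti/andP.
apply: le_Rintegral => //=.
- exact: integrable_norm fi.
- by apply: continuous_itv_integrable => x _; exact: cvg_cst.
Qed.

Lemma Rintegral_odd f a : 0 <= a -> continuous f -> (forall x, f (- x) = - f x) ->
  \int[mu]_(x in `[- a, a]) f x = 0.
Proof.
move=> a0 cf fN.
have fi : mu.-integrable `[- a, a] (EFin \o f).
  by apply: continuous_itv_integrable => x _; exact: cf.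
have : \int[mu]_(x in `[- a, a]) f x = - \int[mu]_(x in `[- a, a]) f x.
  rewrite {1}/Rintegral -{2}[a]opprK integration_by_substitution_oppr//;
    last 2 first.
  - by rewrite ge0_cp.
  - by apply: continuous_subspaceT.
  rewrite -[RHS]mulN1r -RintegralZl//; congr fine; apply: eq_integral => x _ /=.
  by rewrite fN mulN1r.
by move: (Rintegral _ _ _) => I; lra.
Qed.

End Bounds.

(** * The scalar kernel and its Laplace transform *)

Section Profile.
Context {R : realType}.
Notation mu := (@lebesgue_measure R).
Implicit Types (f : R -> R) (a b t x y z C : R).
Local Notation I11 := (`[- 1 : R, 1]%classic).
Local Notation Ry := (`[0 : R, +oo[%classic).

(** One factor z comes from p . e in [L2bar], the other from applying [sigma] to e; 1 - z^2 = sin^2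
    theta comes from the two horizontal components of p. *)
Definition weight z : R := z ^+ 2 * (1 - z ^+ 2).
Local Notation w := weight.

Definition profile t : R := \int[mu]_(z in `[- 1, 1]) (cos (z * t) * w z).
Local Notation k := profile.

Lemma weight_continuous : continuous w.
Proof. by rewrite /w; cont. Qed.

Lemma weight_ge0 z : z \in `[- 1, 1] -> 0 <= w z.
Proof.
rewrite in_itv/= => /andP[z1 z2]; apply: mulr_ge0; first exact: sqr_ge0.
by nra.
Qed.

Lemma weight_le1 z : z \in `[- 1, 1] -> `|w z| <= 1.
Proof.
move=> z1; rewrite ger0_norm ?weight_ge0//.
have := sqr_ge0 z; have := weight_ge0 z1; rewrite /w; nra.
Qed.

Lemma itv11_integrable f : continuous f -> mu.-integrable I11 (EFin \o f).
Proof. by move=> cf; apply: continuous_itv_integrable => x _; exact: cf. Qed.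

Lemma profile_integrand_continuous t : continuous (fun z => cos (z * t) * w z).
Proof. by rewrite /w; cont. Qed.

Lemma profile_lipschitz t t' : `|k t - k t'| <= 2 * `|t - t'|.
Proof.
rewrite /k -RintegralB//; try exact/itv11_integrable/profile_integrand_continuous.
rewrite mulrC [X in _ * X](_ : 2 = 1 - (-1)); last by ring.
apply: Rintegral_le_bound; first by lra.
  by move=> z _; move: z; rewrite /w; cont.
move=> z z1; rewrite -mulrBl normrM.
apply: (@le_trans _ _ (`|t - t'| * 1)); last by rewrite mulr1.
apply: ler_pM => //; last exact: weight_le1.
apply: le_trans (cos_lipschitz _ _) _; rewrite -mulrBr normrM.
by apply: ler_piMl => //; rewrite ler_norml; move: z1; rewrite in_itv.
Qed.

Lemma profile_continuous : continuous k.
Proof.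
move=> t; apply/cvgrPdist_le => /= e e0; near=> t'.
apply: le_trans (profile_lipschitz _ _) _.
rewrite -ler_pdivlMl//; near: t'.
by apply/nbhs_ballP; exists (2^-1 * e) => /= [|y /ltW//]; rewrite mulr_gt0.
Unshelve. all: by end_near. Qed.

(* two integrations by parts; [w] vanishes at the endpoints but [w'] does not *)
Lemma profile_decay t : 0 <= t -> `|k t| <= 52 / (1 + t) ^+ 2.
Proof.
move=> t0.
have k2 : `|k t| <= 2.
  rewrite (_ : 2 = 1 * (1 - (-1))); last by ring.
  apply: Rintegral_le_bound; first by lra.
    by move=> z _; exact: profile_integrand_continuous.
  move=> z z1; rewrite normrM -[leRHS]mulr1.
  by apply: ler_pM => //; [exact: cos_max|exact: weight_le1].
(* 24 = 4 + 20: the boundary term is - 4 cos t because w' takes the values 2 and -2 at -1 and 1, and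
   |w''| = |2 - 12 z^2| <= 10 on an interval of length 2. *)
have kt : `|t ^+ 2 * k t| <= 24.
  have c2 : continuous (fun z => (2 - 12 * z ^+ 2) * cos (z * t)) by cont.
  have E : t ^+ 2 * k t + \int[mu]_(z in I11) ((2 - 12 * z ^+ 2) * cos (z * t)) =
    - 4 * cos t.
    rewrite /k -RintegralZl//; last
      exact/itv11_integrable/profile_integrand_continuous.
    rewrite -RintegralD//; last 2 first.
    - by apply: itv11_integrable; rewrite /w; cont.
    - exact: itv11_integrable.
    rewrite (Rintegral_FTC (F := fun z =>
      w z * t * sin (z * t) + (2 * z - 4 * z ^+ 3) * cos (z * t))).
    - by rewrite /w !mulNr !mul1r sinN cosN; ring.
    - lra.
    - by move=> z _; move: z; rewrite /w; cont.
    - move=> z _; rewrite /w; derive; rewrite /=; ring.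
  have B : `|\int[mu]_(z in I11) ((2 - 12 * z ^+ 2) * cos (z * t))| <= 20.
    rewrite (_ : 20 = 10 * (1 - (-1))); last by ring.
    apply: Rintegral_le_bound; first by lra.
      by move=> z _; exact: c2.
    move=> z; rewrite in_itv/= => /andP[z1 z2]; rewrite normrM -[leRHS]mulr1.
    apply: ler_pM => //; last exact: cos_max.
    by rewrite ler_norml; apply/andP; split; nra.
  have -> : t ^+ 2 * k t = - 4 * cos t - \int[mu]_(z in I11) ((2 - 12 * z ^+ 2) *
    cos (z * t)).
    by rewrite -E addrK.
  apply: le_trans (ler_normB _ _) _.
  rewrite [leRHS](_ : 24 = 4 * 1 + 20); last by ring.
  apply: lerD => //; rewrite normrM normrN normr_nat.
  by apply: ler_wpM2l => //; exact: cos_max.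
(* From (1 + t)^2 <= 2 (1 + t^2) the constant is 2 (2 + 24) = 52. *)
rewrite ler_pdivlMr; last by rewrite exprn_gt0//; lra.
rewrite normrM ger0_norm ?sqr_ge0// in kt.
by have := normr_ge0 (k t); nra.
Qed.

(** The function (1 + t)^(-3/2): what is left of the decay (1 + t)^(-2) once the Hölder estimate has
    used a factor sqrt (1 + t). Its antiderivative is explicit. *)
Definition majorant t : R := ((1 + t) * Num.sqrt (1 + t))^-1.

Lemma D_majorant t : 0 <= t ->
  has_derive (fun s => - 2 * (Num.sqrt (1 + s))^-1) t (majorant t).
Proof.
move=> t0; have t1 : 0 < 1 + t by lra.
have s0 : Num.sqrt (1 + t) != 0 by rewrite gt_eqF ?sqrtr_gt0.
derive => //; rewrite /majorant sqr_sqrtr; last exact: ltW.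
by field; rewrite s0 gt_eqF.
Qed.

Lemma majorant_continuous t : 0 <= t -> {for t, continuous majorant}.
Proof.
move=> t0; have t1 : 0 < 1 + t by lra.
have s0 : Num.sqrt (1 + t) != 0 by rewrite gt_eqF ?sqrtr_gt0.
eapply D_continuous; rewrite /majorant; derive_rule => //.
by rewrite mulf_neq0// gt_eqF.
Qed.

Lemma majorant_ge0 t : 0 <= t -> 0 <= majorant t.
Proof.
move=> t0; rewrite invr_ge0 mulr_ge0// ?sqrtr_ge0//; lra.
Qed.

Lemma majorant_integrable : mu.-integrable Ry (EFin \o majorant).
Proof.
apply: (ge0_integrable_FTCy (F := fun s =>
  - 2 * (Num.sqrt (1 + s))^-1) (l := - 2 * 0)).
- exact: majorant_continuous.
- exact: D_majorant.
- exact: majorant_ge0.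
- apply: cvgM; first exact: cvg_cst.
  apply/cvgrPdist_le => /= e e0; near=> t.
  have t0 : 0 <= t by near: t; apply: nbhs_pinfty_ge; exact: num_real.
  rewrite sub0r normrN ger0_norm ?invr_ge0 ?sqrtr_ge0//.
  rewrite -[e]invrK lef_pV2 ?posrE ?invr_gt0//; last first.
    by rewrite sqrtr_gt0; lra.
  have ei : 0 <= e^-1 by rewrite invr_ge0 ltW.
  rewrite -[leLHS](ger0_norm ei) -sqrtr_sqr; apply: ler_wsqrtr.
  rewrite -lerBlDl; near: t; apply: nbhs_pinfty_ge; exact: num_real.
Unshelve. all: by end_near. Qed.

End Profile.

(** * Continuity of the transform up to the imaginary axis *)

Section LaplaceProfile.
Context {R : realType}.
Notation mu := (@lebesgue_measure R).
Implicit Types (f g F : R -> R) (a b t x y z C d : R).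
Local Notation Ry := (`[0 : R, +oo[%classic).
Local Notation k := (@profile R).

Lemma profile_majorant t : 0 <= t -> `|k t| <= 52 * majorant t.
Proof.
move=> t0; apply: le_trans (profile_decay t0) _; apply: ler_wpM2l => //.
have t1 : 1 <= 1 + t by lra.
have s1 : 1 <= Num.sqrt (1 + t) by rewrite -[leLHS]sqrtr1 ler_wsqrtr.
rewrite /majorant lef_pV2 ?posrE ?exprn_gt0 ?mulr_gt0//; try lra.
have := sqr_sqrtr (_ : 0 <= 1 + t); move=> /(_ ltac:(lra)); nra.
Qed.

Let bounded_profile_le f t : (forall t, 0 <= t -> `|f t| <= 1) -> 0 <= t ->
  `|f t * k t| <= 52 * majorant t.
Proof.
move=> f1 t0; rewrite normrM -[leRHS]mul1r; apply: ler_pM => //; first exact: f1.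
exact: profile_majorant.
Qed.

Let majorant52_integrable : mu.-integrable Ry (EFin \o (fun t => 52 * majorant t)).
Proof. by apply: eq_integrable (integrableZl _ 52 majorant_integrable). Qed.

Lemma bounded_profile_integrable f : continuous f ->
  (forall t, 0 <= t -> `|f t| <= 1) ->
  mu.-integrable Ry (EFin \o (fun t => f t * k t)).
Proof.
move=> cf f1; apply: dominated_itvy_integrable majorant52_integrable.
  by move=> t _; apply: cvgM; [exact: cf|exact: profile_continuous].
by move=> t; exact: bounded_profile_le.
Qed.

(** With the 52 of [profile_decay], this is both the constant of the Hölder-1/2 estimates and a
    uniform bound of the transform on the closed half-plane. *)
Definition holder_const : R := 52 * \int[mu]_(t in Ry) majorant t.

Lemma holder_const_ge0 : 0 <= holder_const.
Proof.
apply: mulr_ge0 => //; apply: Rintegral_ge0 => t.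
by rewrite /= in_itv/= andbT; exact: majorant_ge0.
Qed.

Lemma bounded_profile_bound f : continuous f ->
  (forall t, 0 <= t -> `|f t| <= 1) ->
  `|\int[mu]_(t in Ry) (f t * k t)| <= holder_const.
Proof.
move=> cf f1; have fi := bounded_profile_integrable cf f1.
apply: le_trans (le_normr_Rintegral _ fi) _ => //.
rewrite /holder_const -RintegralZl//; last exact: majorant_integrable.
apply: le_Rintegral => //; first exact: integrable_norm fi.
by move=> t; rewrite /= in_itv/= andbT; exact: bounded_profile_le.
Qed.

(* [|f t - g t| <= min 2 (d * t) <= sqrt (2 * d * t)], which the quadratic decay
   of [profile] makes integrable *)
Lemma profile_holder f g d : continuous f -> continuous g ->
  (forall t, 0 <= t -> `|f t| <= 1) -> (forall t, 0 <= t -> `|g t| <= 1) ->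
  (forall t, 0 <= t -> `|f t - g t| <= d * t) ->
  `|\int[mu]_(t in Ry) (f t * k t) - \int[mu]_(t in Ry) (g t * k t)| <=
  holder_const * Num.sqrt (2 * d).
Proof.
move=> cf cg f1 g1 fg.
have fi := bounded_profile_integrable cf f1.
have gi := bounded_profile_integrable cg g1.
rewrite -RintegralB//.
have fgi : mu.-integrable Ry (EFin \o (fun t => f t * k t - g t * k t)).
  by apply: eq_integrable (integrableB _ fi gi).
apply: le_trans (le_normr_Rintegral _ fgi) _ => //.
have -> : holder_const * Num.sqrt (2 * d) =
    \int[mu]_(t in Ry) (52 * Num.sqrt (2 * d) * majorant t).
  by rewrite RintegralZl//; [rewrite /holder_const mulrAC|exact:
    majorant_integrable].
apply: le_Rintegral => //.
- exact: integrable_norm fgi.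
- by apply: eq_integrable (integrableZl _ (52 * Num.sqrt (2 * d))
    majorant_integrable).
move=> t; rewrite /= in_itv/= andbT => t0; rewrite -mulrBl normrM.
have d0 : 0 <= d * t by exact: le_trans (fg _ t0).
have fg2 : `|f t - g t| <= Num.sqrt (2 * d) * Num.sqrt (1 + t).
  have d0' : 0 <= 2 * d * (1 + t).
    (* The hypothesis at t = 1 gives d >= 0. *)
    have := fg 1 ler01; have := normr_ge0 (f 1 - g 1); nra.
  rewrite -sqrtrM; last by have := fg 1 ler01; have := normr_ge0 (f 1 - g 1); lra.
  rewrite -[leLHS]ger0_norm// -sqrtr_sqr ler_wsqrtr//.
  have : `|f t - g t| <= 2.
    apply: le_trans (ler_normB _ _) _; have := f1 _ t0; have := g1 _ t0; lra.
  have := fg _ t0; have := normr_ge0 (f t - g t).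
  have := fg 1 ler01; have := normr_ge0 (f 1 - g 1); nra.
have t1 : 0 < 1 + t by lra.
have s0 : 0 < Num.sqrt (1 + t) by rewrite sqrtr_gt0.
have s2 : Num.sqrt (1 + t) ^+ 2 = 1 + t by rewrite sqr_sqrtr// ltW.
apply: le_trans (ler_pM _ _ fg2 (profile_decay t0)) _ => //.
rewrite le_eqVlt; apply/orP; left; apply/eqP.
rewrite /majorant; move: s0 s2 {fg2}; move: (Num.sqrt (1 + t)) => s s0 <-.
by field; rewrite gt_eqF.
Qed.

(** Real and imaginary parts of L (x + i y) are kept as integrals in time, which also make sense at
    x = 0, where the integral in z becomes singular. *)
Definition lap_re x y : R :=
  \int[mu]_(t in Ry) (expR (- (x * t)) * cos (y * t) * k t).
Definition lap_im x y : R :=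
  - \int[mu]_(t in Ry) (expR (- (x * t)) * sin (y * t) * k t).

Lemma expR_trig_le1 x y t (g : R -> R) : (forall a, `|g a| <= 1) -> 0 <= x ->
  0 <= t ->
  `|expR (- (x * t)) * g (y * t)| <= 1.
Proof.
move=> g1 x0 t0; rewrite normrM -[leRHS]mulr1; apply: ler_pM => //.
by rewrite ger0_norm ?expR_ge0// expRN_le1// mulr_ge0.
Qed.

Lemma expR_trig_lipschitz x y x' y' t (g : R -> R) :
  (forall a, `|g a| <= 1) -> (forall a b, `|g a - g b| <= `|a - b|) ->
  0 <= x -> 0 <= x' -> 0 <= t ->
  `|expR (- (x * t)) * g (y * t) - expR (- (x' * t)) * g (y' * t)| <=
  (`|x - x'| + `|y - y'|) * t.
Proof.
move=> g1 gl x0 x'0 t0.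
have -> : expR (- (x * t)) * g (y * t) - expR (- (x' * t)) * g (y' * t) =
  (expR (- (x * t)) - expR (- (x' * t))) * g (y * t) +
  expR (- (x' * t)) * (g (y * t) - g (y' * t)) by ring.
apply: le_trans (ler_normD _ _) _; rewrite [leRHS]mulrDl; apply: lerD;
  rewrite normrM.
  rewrite -[leRHS]mulr1; apply: ler_pM => //.
  apply: le_trans (expRN_lipschitz _ _) _; rewrite ?mulr_ge0//.
  by rewrite -mulrBl normrM (ger0_norm t0).
rewrite -[leRHS]mul1r; apply: ler_pM => //.
  by rewrite ger0_norm ?expR_ge0// expRN_le1// mulr_ge0.
apply: le_trans (gl _ _) _.
by rewrite -mulrBl normrM (ger0_norm t0).
Qed.

Lemma lap_re_holder x y x' y' : 0 <= x -> 0 <= x' ->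
  `|lap_re x y - lap_re x' y'| <=
  holder_const * Num.sqrt (2 * (`|x - x'| + `|y - y'|)).
Proof.
move=> x0 x'0.
apply: (@profile_holder (fun t => expR (- (x * t)) * cos (y * t))
                        (fun t => expR (- (x' * t)) * cos (y' * t))).
- by cont.
- by cont.
- by move=> t t0; apply: expR_trig_le1 => //; exact: cos_max.
- by move=> t t0; apply: expR_trig_le1 => //; exact: cos_max.
- by move=> t t0; apply: expR_trig_lipschitz => //;
    [exact: cos_max|exact: cos_lipschitz].
Qed.

Lemma lap_im_holder x y x' y' : 0 <= x -> 0 <= x' ->
  `|lap_im x y - lap_im x' y'| <=
  holder_const * Num.sqrt (2 * (`|x - x'| + `|y - y'|)).
Proof.
move=> x0 x'0; rewrite /lap_im -opprD normrN.
apply: (@profile_holder (fun t => expR (- (x * t)) * sin (y * t))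
                        (fun t => expR (- (x' * t)) * sin (y' * t))).
- by cont.
- by cont.
- by move=> t t0; apply: expR_trig_le1 => //; exact: sin_max.
- by move=> t t0; apply: expR_trig_le1 => //; exact: sin_max.
- by move=> t t0; apply: expR_trig_lipschitz => //;
    [exact: sin_max|exact: sin_lipschitz].
Qed.

Lemma lap_re_bound x y : 0 <= x -> `|lap_re x y| <= holder_const.
Proof.
move=> x0; apply: (@bounded_profile_bound (fun t =>
  expR (- (x * t)) * cos (y * t))).
  by cont.
by move=> t t0; apply: expR_trig_le1 => //; exact: cos_max.
Qed.

(** With [lap_imN], this is the symmetry of L under conjugation: it reduces the imaginary axis to y
    >= 0 and makes L real on the positive reals. *)
Lemma lap_reN x y : lap_re x (- y) = lap_re x y.
Proof. by apply: eq_Rintegral => t _; rewrite mulNr cosN. Qed.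

Lemma lap_imN x y : 0 <= x -> lap_im x (- y) = - lap_im x y.
Proof.
move=> x0; rewrite /lap_im; congr -%R; rewrite -[RHS]mulN1r -RintegralZl//.
  by apply: eq_Rintegral => t _; rewrite mulNr sinN; ring.
apply: (@bounded_profile_integrable (fun t => expR (- (x * t)) * sin (y * t)));
  first by cont.
by move=> t t0; apply: expR_trig_le1 => //; exact: sin_max.
Qed.

End LaplaceProfile.

(** * The transform as an integral in z *)

Section ExpTrig.
Context {R : realType}.
Notation mu := (@lebesgue_measure R).
Implicit Types (f g F : R -> R) (a b t x y z C d : R).
Local Notation I11 := (`[- 1 : R, 1]%classic).
Local Notation Ry := (`[0 : R, +oo[%classic).
Local Notation w := (@weight R).

Lemma cvgy_expRN_bounded x f C : 0 < x -> (forall t, `|f t| <= C) ->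
  expR (- (x * t)) * f t @[t --> +oo%R] --> (0 : R).
Proof.
move=> x0 fC; apply: (@squeeze_cvgr _ _ _ _ (fun t =>
  - C * expR (- (x * t))) (fun t => C * expR (- (x * t)))).
- near=> t; have /ler_normlP[h1 h2] := fC t.
  by have e0 := expR_ge0 (- (x * t)); apply/andP; split; nra.
- by rewrite -[X in _ --> X](mulr0 (- C)); apply: cvgM;
    [exact: cvg_cst|exact: cvgy_expRN].
- by rewrite -[X in _ --> X](mulr0 C); apply: cvgM;
    [exact: cvg_cst|exact: cvgy_expRN].
Unshelve. all: by end_near. Qed.

Lemma D_expRN x t : x != 0 -> has_derive (fun t =>
  - x^-1 * expR (- (x * t))) t (expR (- (x * t))).
Proof. by move=> x0; derive; field. Qed.

Lemma expRN_integrable x : 0 < x -> mu.-integrable Ry (EFin \o (fun t =>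
  expR (- (x * t)))).
Proof.
move=> x0.
apply: (ge0_integrable_FTCy (F := fun t =>
  - x^-1 * expR (- (x * t))) (l := - x^-1 * 0)).
- by move=> t _; move: t; cont.
- by move=> t _; apply: D_expRN; rewrite gt_eqF.
- by move=> t _; exact: expR_ge0.
- by apply: cvgM; [exact: cvg_cst|exact: cvgy_expRN].
Qed.

Let expRN_FTCy x f F : 0 < x -> continuous f ->
  (forall t, has_derive F t (f t)) -> F t @[t --> +oo%R] --> (0 : R) ->
  (forall t, 0 <= t -> `|f t| <= expR (- (x * t))) ->
  \int[mu]_(t in Ry) f t = - F 0.
Proof.
move=> x0 cf dF F0 fx; rewrite -[RHS]add0r.
apply: (dominated_FTCy (g := fun t => expR (- (x * t)))
  (G := fun t => - x^-1 * expR (- (x * t))) (m := - x^-1 * 0)) => //.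
- by move=> t _; exact: cf.
- by move=> t _; move: t; cont.
- by move=> t _; apply: D_expRN; rewrite gt_eqF.
- by apply: cvgM; [exact: cvg_cst|exact: cvgy_expRN].
Qed.

Lemma sqr_sum_gt0 x y : 0 < x -> 0 < x ^+ 2 + y ^+ 2.
Proof. by move=> x0; have := sqr_ge0 y; have := exprn_gt0 2 x0; lra. Qed.

Lemma Rintegral_expRN_cos x a : 0 < x ->
  \int[mu]_(t in Ry) (expR (- (x * t)) * cos (a * t)) = x / (x ^+ 2 + a ^+ 2).
Proof.
move=> x0; have q0 := sqr_sum_gt0 a x0.
(* The real part of the antiderivative - e^(-(x - i a) t) / (x - i a); its imaginary part serves for
   the sine below. *)
rewrite (@expRN_FTCy x _ (fun t => expR (- (x * t)) *
  ((a * sin (a * t) - x * cos (a * t)) / (x ^+ 2 + a ^+ 2))))//.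
- by rewrite !mulr0 oppr0 expR0 sin0 cos0; field; rewrite gt_eqF.
- by cont.
- by move=> t; derive; rewrite /=; field; rewrite gt_eqF.
- apply: (@cvgy_expRN_bounded _ _ ((`|a| + `|x|) / (x ^+ 2 + a ^+ 2))) => // t.
  rewrite normrM normfV (gtr0_norm q0) ler_pM2r ?invr_gt0//.
  apply: le_trans (ler_normB _ _) _; rewrite !normrM.
  by apply: lerD; apply: ler_piMr => //; [exact: sin_max|exact: cos_max].
- move=> t t0; rewrite normrM ger0_norm ?expR_ge0//.
  by apply: ler_piMr; [exact: expR_ge0|exact: cos_max].
Qed.

Lemma Rintegral_expRN_sin x a : 0 < x ->
  \int[mu]_(t in Ry) (expR (- (x * t)) * sin (a * t)) = a / (x ^+ 2 + a ^+ 2).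
Proof.
move=> x0; have q0 := sqr_sum_gt0 a x0.
rewrite (@expRN_FTCy x _ (fun t => expR (- (x * t)) *
  (- (x * sin (a * t) + a * cos (a * t)) / (x ^+ 2 + a ^+ 2))))//.
- by rewrite !mulr0 oppr0 expR0 sin0 cos0; field; rewrite gt_eqF.
- by cont.
- by move=> t; derive; rewrite /=; field; rewrite gt_eqF.
- apply: (@cvgy_expRN_bounded _ _ ((`|x| + `|a|) / (x ^+ 2 + a ^+ 2))) => // t.
  rewrite normrM normfV (gtr0_norm q0) ler_pM2r ?invr_gt0// normrN.
  apply: le_trans (ler_normD _ _) _; rewrite !normrM.
  by apply: lerD; apply: ler_piMr => //; [exact: sin_max|exact: cos_max].
- move=> t t0; rewrite normrM ger0_norm ?expR_ge0//.
  by apply: ler_piMr; [exact: expR_ge0|exact: sin_max].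
Qed.

Let expRN_trig_integrable (g : R -> R) x a : 0 < x -> continuous g ->
  (forall b, `|g b| <= 1) ->
  mu.-integrable Ry (EFin \o (fun t => expR (- (x * t)) * g (a * t))).
Proof.
move=> x0 cg g1; apply: dominated_itvy_integrable (expRN_integrable x0) => t t0.
  have ce : continuous (fun s => expR (- (x * s))) by cont.
  apply: cvgM; first exact: ce.
  by apply: (@continuous_comp _ _ _ ( *%R a) g);
    [exact: mulrl_continuous|exact: cg].
rewrite normrM ger0_norm ?expR_ge0//.
by apply: ler_piMr; [exact: expR_ge0|].
Qed.

(** The integrand is dominated by e^(-x t) times the constant 1 on [-1, 1], integrable precisely
    because x > 0. *)
Let profile_fubini (g : R -> R) x y : 0 < x -> continuous g ->
  (forall a, `|g a| <= 1) ->
  \int[mu]_(t in Ry) \int[mu]_(z in I11) (expR (- (x * t)) * g ((y + z) * t) * w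
    z) =
  \int[mu]_(z in I11) \int[mu]_(t in Ry) (expR (- (x * t)) * g ((y + z) * t) * w z).
Proof.
move=> x0 cg g1.
have mg : measurable_fun setT g by exact: continuous_measurable_fun.
have mw : measurable_fun setT w by apply: continuous_measurable_fun;
  exact: weight_continuous.
have [||||||E1 E2] := @Rintegral_fubini _ _ (measurableTypeR R) (measurableTypeR
  R) R mu mu Ry I11
  (fun p : R * R => expR (- (x * p.1)) * g ((y + p.2) * p.1) * w p.2)
  (fun t => expR (- (x * t))) (cst 1).
- by [].
- by [].
- apply: measurable_funM; last exact: measurableT_comp mw measurable_snd.
  apply: measurable_funM.
    apply: measurableT_comp => //; apply: measurableT_comp => //.
    by apply: measurable_funM => //; exact: measurable_fst.
  apply: measurableT_comp mg _; apply: measurable_funM; last exact: measurable_fst.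
  by apply: measurable_funD => //; exact: measurable_snd.
- exact: expRN_integrable.
- by apply: itv11_integrable => ?; exact: cvg_cst.
- move=> t z t0 z1; rewrite normrM; apply: ler_pM => //; last exact: weight_le1.
  rewrite normrM ger0_norm ?expR_ge0//.
  by apply: ler_piMr; [exact: expR_ge0|].
exact: etrans (esym E1) E2.
Qed.

Lemma profile_sin t : \int[mu]_(z in I11) (sin (z * t) * w z) = 0.
Proof.
apply: Rintegral_odd; first by lra.
  by rewrite /w; cont.
by move=> z; rewrite /weight mulNr sinN sqrrN mulNr.
Qed.

(** As [w] is even, the terms in sin (z t) integrate to 0, so the addition formula replaces cos (y
    t) cos (z t) by cos ((y + z) t). After the exchange of integrals, the inner one is an elementary
    Laplace transform. *)
Lemma lap_reE x y : 0 < x ->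
  lap_re x y = \int[mu]_(z in I11) (w z * (x / (x ^+ 2 + (y + z) ^+ 2))).
Proof.
move=> x0.
transitivity (\int[mu]_(t in Ry) \int[mu]_(z in I11) (expR (- (x * t)) * cos ((y
  + z) * t) * w z)).
  apply: eq_Rintegral => t _.
  transitivity (\int[mu]_(z in I11) (expR (- (x * t)) * cos (y * t) * (cos (z *
    t) * w z) -
     expR (- (x * t)) * sin (y * t) * (sin (z * t) * w z))).
    rewrite RintegralB//; try by apply: itv11_integrable; rewrite /w; cont.
    rewrite !RintegralZl//; try by apply: itv11_integrable; rewrite /w; cont.
    by rewrite profile_sin mulr0 subr0.
  by apply: eq_Rintegral => z _; rewrite [(y + z) * t]mulrDl cosD; ring.
rewrite (@profile_fubini cos)//; last 2 first.
- exact: continuous_cos.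
- exact: cos_max.
apply: eq_Rintegral => z _.
rewrite RintegralZr//; first by rewrite Rintegral_expRN_cos// mulrC.
by apply: expRN_trig_integrable => //; [exact: continuous_cos|exact: cos_max].
Qed.

Lemma lap_imE x y : 0 < x ->
  lap_im x y = - \int[mu]_(z in I11) (w z * ((y + z) / (x ^+ 2 + (y + z) ^+ 2))).
Proof.
move=> x0; congr -%R.
transitivity (\int[mu]_(t in Ry) \int[mu]_(z in I11) (expR (- (x * t)) * sin ((y
  + z) * t) * w z)).
  apply: eq_Rintegral => t _.
  transitivity (\int[mu]_(z in I11) (expR (- (x * t)) * sin (y * t) * (cos (z *
    t) * w z) +
     expR (- (x * t)) * cos (y * t) * (sin (z * t) * w z))).
    rewrite RintegralD//; try by apply: itv11_integrable; rewrite /w; cont.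
    rewrite !RintegralZl//; try by apply: itv11_integrable; rewrite /w; cont.
    by rewrite profile_sin mulr0 addr0.
  by apply: eq_Rintegral => z _; rewrite [(y + z) * t]mulrDl sinD; ring.
rewrite (@profile_fubini sin)//; last 2 first.
- exact: continuous_sin.
- exact: sin_max.
apply: eq_Rintegral => z _.
rewrite RintegralZr//; first by rewrite Rintegral_expRN_sin// mulrC.
by apply: expRN_trig_integrable => //; [exact: continuous_sin|exact: sin_max].
Qed.

End ExpTrig.

(** * Minimum modulus principle in the half-plane *)

Section ComplexNorm.
Context {R : realType}.
Local Notation C := R[i].
Local Notation normc := (@normc R).
Implicit Types (x y z h l : C).

Lemma normc_ge0 z : 0 <= normc z.
Proof. by case: z => a b; exact: sqrtr_ge0. Qed.

Lemma normc_le_ReIm (z : C) : normc z <= `|complex.Re z| + `|complex.Im z|.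
Proof.
case: z => a b /=.
have ab0 : 0 <= `|a| + `|b| by rewrite addr_ge0.
rewrite -[leRHS]ger0_norm// -sqrtr_sqr; apply: ler_wsqrtr.
rewrite sqrrD !real_normK ?num_real//.
have : 0 <= `|a| * `|b| by rewrite mulr_ge0.
by rewrite mulr2n; lra.
Qed.

Lemma normc_ge_Re z : `|complex.Re z| <= normc z.
Proof.
case: z => a b /=; rewrite -sqrtr_sqr; apply: ler_wsqrtr.
by rewrite lerDl sqr_ge0.
Qed.

Lemma normc_ge_Im z : `|complex.Im z| <= normc z.
Proof.
case: z => a b /=; rewrite -sqrtr_sqr; apply: ler_wsqrtr.
by rewrite lerDr sqr_ge0.
Qed.

Lemma normc_real (a : R) : normc a%:C%C = `|a|.
Proof. by rewrite /= expr0n addr0 sqrtr_sqr. Qed.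

Lemma normcD x y : normc (x + y) <= normc x + normc y.
Proof. exact: le_normcD. Qed.

Lemma normc_opp x : normc (- x) = normc x.
Proof. exact: normcN. Qed.

Lemma normcB x y : normc (x - y) <= normc x + normc y.
Proof. by rewrite -(normc_opp y) normcD. Qed.

Lemma normcB_ge x y : normc x - normc y <= normc (x - y).
Proof. by rewrite lerBlDr -{1}[x](subrK y) normcD. Qed.

Lemma normcD_ge x y : normc x - normc y <= normc (x + y).
Proof. by rewrite -(normc_opp y) -[y in leRHS]opprK normcB_ge. Qed.

Lemma normcX x n : normc (x ^+ n) = normc x ^+ n.
Proof. by elim: n => [|n ih]; rewrite ?normc1// !exprS normcM ih. Qed.

Lemma normc_eq0 x : (normc x == 0) = (x == 0).
Proof. by apply/eqP/eqP => [/eq0_normc//|->]; rewrite normc0. Qed.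

Lemma normc_gt0 x : (0 < normc x) = (x != 0).
Proof. by rewrite lt0r normc_ge0 andbT normc_eq0. Qed.

Lemma normc_quadratic (a b c h : C) : normc h <= 1 ->
  normc (a + b * h + c * h ^+ 2) <= normc a + normc b + normc c.
Proof.
move=> h1; have h0 := normc_ge0 h.
apply: le_trans (normcD _ _) _; apply: lerD; last first.
  rewrite normcM normcX ler_piMr ?normc_ge0//.
  by rewrite expr_le1.
apply: le_trans (normcD _ _) _; apply: lerD => //.
by rewrite normcM ler_piMr ?normc_ge0.
Qed.

End ComplexNorm.

Section Taylor.
Context {R : realType}.
Local Notation C := R[i].
Local Notation normc := (@normc R).
Implicit Types (x y z h l a b c : C) (f g : C -> C).

(** Stands in for holomorphy at l: it is stable under subtraction of constants and inversion, and
    its cubic remainder is negligible against the r^2 gained in the maximum principle. *)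
Definition taylor2 f l a b c : Prop := exists K r0 : R, [/\ 0 <= K, 0 < r0 &
  forall h, normc h <= r0 ->
    normc (f (l + h) - (a + b * h + c * h ^+ 2)) <= K * normc h ^+ 3].

Lemma taylor2_value f l a b c : taylor2 f l a b c -> f l = a.
Proof.
move=> [K [r0 [K0 r00 /(_ 0)]]]; rewrite normc0 => /(_ (ltW r00)).
rewrite !expr0n/= !mulr0 !addr0 => le0.
apply/eqP; rewrite -subr_eq0 -normc_eq0 eq_le le0; exact: normc_ge0.
Qed.

Lemma taylor2_subC f l a b c s : taylor2 f l a b c ->
  taylor2 (fun z => f z - s) l (a - s) b c.
Proof.
move=> [K [r0 [K0 r00 fE]]]; exists K, r0; split => // h /fE.
by congr (normc _ <= _); ring.
Qed.

Lemma taylor2_inv f l a b c : a != 0 -> taylor2 f l a b c ->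
  taylor2 (fun z => (f z)^-1) l a^-1 (- b / a ^+ 2) ((b ^+ 2 - a * c) / a ^+ 3).
Proof.
move=> a0 [K [r0 [K0 r00 fE]]].
set b1 := - b / a ^+ 2; set b2 := (b ^+ 2 - a * c) / a ^+ 3.
pose K1 := normc b + normc c + K.
have K10 : 0 <= K1 by rewrite !addr_ge0 ?normc_ge0.
have na : 0 < normc a by rewrite normc_gt0.
pose B := normc a^-1 + normc b1 + normc b2.
have B0 : 0 <= B by rewrite !addr_ge0 ?normc_ge0.
(* The product of the two quadratic polynomials is 1 + q0 h^3 + q1 h^4. *)
pose q0 := b1 * c + b2 * b; pose q1 := b2 * c.
pose Q := normc q0 + normc q1 + B * K.
have Q0 : 0 <= Q by rewrite !addr_ge0 ?mulr_ge0 ?normc_ge0.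
(* The last bound on |h| ensures |f (l + h)| >= |a| / 2, whence the factor 2 / |a|; |h| <= 1 lets
   lower powers of h absorb higher ones. *)
exists (Q * (2 / normc a)), (Num.min (Num.min r0 1) (normc a / (2 * (K1 + 1)))).
split.
- by rewrite mulr_ge0// divr_ge0// ltW.
- by rewrite !lt_min r00 ltr01/= divr_gt0// mulr_gt0//; lra.
move=> h; rewrite !le_min => /andP[/andP[hr0 h1] ha].
have h0 := normc_ge0 h.
have hK : normc h * K1 <= normc a / 2.
  apply: (@le_trans _ _ (normc a / (2 * (K1 + 1)) * (K1 + 1))).
    by apply: ler_pM => //; lra.
  by rewrite le_eqVlt; apply/orP; left; apply/eqP; field; lra.
have := fE _ hr0; set e := f (l + h) - _ => he.
have fhE : f (l + h) = a + b * h + c * h ^+ 2 + e by rewrite /e; ring.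
have h31 : normc h ^+ 3 <= normc h.
  by rewrite -[leRHS]mulr1 exprS ler_wpM2l// expr_le1.
have h21 : normc h ^+ 2 <= normc h.
  by rewrite -[leRHS]mulr1 exprS ler_wpM2l// expr_le1.
have fh : normc a / 2 <= normc (f (l + h)).
  have -> : f (l + h) = a + (b * h + c * h ^+ 2 + e) by rewrite fhE; ring.
  apply: le_trans (normcD_ge _ _).
  suff : normc (b * h + c * h ^+ 2 + e) <= normc h * K1 by lra.
  apply: le_trans (normcD _ _) _;
    apply: (@le_trans _ _ (normc b * normc h + normc c * normc h + K * normc h)).
    apply: lerD; last by apply: le_trans he _; exact: ler_wpM2l.
    apply: le_trans (normcD _ _) _; rewrite (normcM b) (normcM c) normcX;
      apply: lerD => //.
    by apply: ler_wpM2l => //; exact: normc_ge0.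
  by rewrite /K1 le_eqVlt; apply/orP; left; apply/eqP; ring.
have fh0 : f (l + h) != 0.
  by rewrite -normc_gt0; apply: lt_le_trans fh; rewrite divr_gt0.
have -> : (f (l + h))^-1 - (a^-1 + b1 * h + b2 * h ^+ 2) =
   (- (h ^+ 3 * (q0 + q1 * h)) - (a^-1 + b1 * h + b2 * h ^+ 2) * e) / f (l + h).
  have -> : e = f (l + h) - (a + b * h + c * h ^+ 2) by [].
  move: (f (l + h)) fh0 => F F0; rewrite /q0 /q1 /b1 /b2; field.
  by rewrite a0 F0.
rewrite [leLHS]normcM normcV [leRHS]mulrAC; apply: ler_pM.
- exact: normc_ge0.
- by rewrite invr_ge0 normc_ge0.
- apply: le_trans (normcB _ _) _;
    rewrite normc_opp (normcM (h ^+ 3)) (normcM _ e) normcX.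
  apply: (@le_trans _ _ (normc h ^+ 3 * (normc q0 + normc q1) + B * (K * normc h
    ^+ 3))).
    apply: lerD.
      apply: ler_wpM2l; first exact: exprn_ge0.
      apply: le_trans (normcD _ _) _; rewrite normcM; apply: lerD => //.
      by rewrite ler_piMr ?normc_ge0.
    apply: ler_pM; rewrite ?normc_ge0//.
    exact: normc_quadratic.
  by rewrite /Q le_eqVlt; apply/orP; left; apply/eqP; ring.
- by rewrite -invf_div lef_pV2 ?posrE ?normc_gt0 ?divr_gt0.
Qed.

(* 4-point mean value inequality: the roots of unity 1, -1, i, -i kill
   the linear and the quadratic terms of the Taylor expansion *)
Lemma taylor2_mean f l a b c : taylor2 f l a b c ->
  exists K r0 : R, [/\ 0 <= K, 0 < r0 & forall r : R, 0 <= r <= r0 ->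
  4 * normc (f l) <= normc (f (l + r%:C%C)) + normc (f (l - r%:C%C)) +
    normc (f (l + 'i%C * r%:C%C)) + normc (f (l - 'i%C * r%:C%C)) + K * r ^+ 3].
Proof.
move=> T; have fl := taylor2_value T; move: T => [K [r0 [K0 r00 fE]]].
exists (4 * K), r0; split => // [|r /andP[r_ge0 rr0]]; first by rewrite mulr_ge0.
pose e h := f (l + h) - (a + b * h + c * h ^+ 2).
have eE h : normc h = r -> normc (e h) <= K * r ^+ 3.
  by move=> hr; rewrite -hr; apply: fE; rewrite hr.
have nr : normc r%:C%C = r by rewrite normc_real ger0_norm.
have nir : normc ('i%C * r%:C%C) = r.
  by rewrite normcM nr /= expr0n expr1n add0r sqrtr1 mul1r.
have E : 4 * f l = (f (l + r%:C%C) + f (l - r%:C%C) +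
    f (l + 'i%C * r%:C%C) + f (l - 'i%C * r%:C%C)) -
    (e r%:C%C + e (- r%:C%C) + e ('i%C * r%:C%C) + e (- ('i%C * r%:C%C))).
  have i2 : 'i%C ^+ 2 = -1 :> C by exact: sqr_i.
  rewrite /e fl; move: (f _) (f _) (f _) (f _) => F1 F2 F3 F4.
  move: i2; move: ('i%C : C) (r%:C%C : C) => i s i2.
  have -> : (- (i * s)) ^+ 2 = - s ^+ 2 by rewrite sqrrN exprMn i2; ring.
  have -> : (i * s) ^+ 2 = - s ^+ 2 by rewrite exprMn i2; ring.
  ring.
have -> : 4 * normc (f l) = normc (4 * f l).
  rewrite normcM; congr (_ * _).
  by rewrite -(rmorph_nat (real_complex R)) normc_real normr_nat.
rewrite E; apply: le_trans (normcB _ _) _; apply: lerD.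
  do 3 (apply: le_trans (normcD _ _) _; apply: lerD => //).
rewrite -mulrA (_ : 4 * (K * r ^+ 3) = K * r ^+ 3 + K * r ^+ 3 + K * r ^+ 3 + K *
  r ^+ 3); last by ring.
apply: le_trans (normcD _ _) _; apply: lerD; last by apply: eE; rewrite normc_opp.
apply: le_trans (normcD _ _) _; apply: lerD; last exact: eE.
apply: le_trans (normcD _ _) _; apply: lerD; first exact: eE.
by apply: eE; rewrite normc_opp.
Qed.

End Taylor.

Section MinimumModulus.
Context {R : realType}.
Local Notation C := R[i].
Local Notation normc := (@normc R).

(* The argument [`|p.1|] only serves to have a function that is continuous on
   the whole plane. *)
Lemma minimum_modulus (f : C -> C) (X Y D : R) : 0 < X -> 0 < Y -> 0 < D ->
  continuous (fun p : R * R => normc (f (Complex `|p.1| p.2))) ->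
  (forall l, 0 < complex.Re l -> exists a b c, taylor2 f l a b c) ->
  (forall l, 0 <= complex.Re l -> f l != 0) ->
  (forall x y, 0 <= x <= X -> - Y <= y <= Y -> [|| x == 0, x == X | `|y| == Y] ->
    D <= normc (f (Complex x y))) ->
  forall x y, 0 <= x <= X -> - Y <= y <= Y -> D <= normc (f (Complex x y)).
Proof.
move=> X0 Y0 D0 cf tf f0 fD x y xX yY.
have x0 : 0 <= x by case/andP: xX.
have nf0 a b : 0 <= a -> 0 < normc (f (Complex a b)).
  by move=> a0; rewrite normc_gt0; apply: f0.
suff : (normc (f (Complex x y)))^-1 <= D^-1.
  by rewrite lef_pV2// posrE nf0.
apply/ler_addgt0Pr => e e0.
(* The function to maximize is |1/f| plus a strictly subharmonic term d |l|^2; by the choice of [M]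
   that term is at most e on the rectangle. *)
pose N (p : R * R) := (normc (f (Complex `|p.1| p.2)))^-1.
pose M := X ^+ 2 + Y ^+ 2 + 1.
have M0 : 0 < M by have := sqr_ge0 X; have := sqr_ge0 Y; rewrite /M; lra.
pose d := e / M.
have d0 : 0 < d by rewrite divr_gt0.
have dM : d * M = e by rewrite /d divfK// gt_eqF.
pose v p := N p + d * (p.1 ^+ 2 + p.2 ^+ 2).
pose K : set (R * R) := `[0, X]%classic `*` `[- Y, Y]%classic.
have Kxy : K (x, y) by split; rewrite /= in_itv.
have cv : continuous v.
  move=> p; apply: cvgD.
    by apply: cvgV; [rewrite gt_eqF// nf0|exact: cf].
  apply: cvgM; first exact: cvg_cst.
  apply: cvgD; apply: cvgM; solve [exact: cvg_fst|exact: cvg_snd].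
have [[a b] /set_mem[/= aX bY] vmax] : exists2 c, c \in K & forall t, t \in K ->
  v t <= v c.
  apply: compact_EVT_max.
  - by exists (x, y).
  - by apply: compact_setX; exact: segment_compact.
  - exact: continuous_subspaceT.
move: aX bY; rewrite /= !in_itv/= => /andP[a0 aX] /andP[bY1 bY2].
have vle s t : 0 <= s -> s <= X -> - Y <= t -> t <= Y -> v (s, t) <= v (a, b).
  move=> s0 sX t1 t2; apply: vmax; apply/mem_set; split; rewrite /= in_itv/=.
    by rewrite s0 sX.
  by rewrite t1 t2.
have [bd|] := boolP [|| a == 0, a == X | `|b| == Y].
  have : v (x, y) <= v (a, b) by apply: vmax; exact/mem_set.
  rewrite /v /N /= (ger0_norm x0) (ger0_norm a0) => vv.
  have Nab : (normc (f (Complex a b)))^-1 <= D^-1.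
    by rewrite lef_pV2 ?posrE ?nf0//; apply: fD => //; rewrite ?a0 ?aX ?bY1 ?bY2.
  move: vv Nab; move: (normc _)^-1 (normc _)^-1 => n1 n2 vv Nab.
  have : a ^+ 2 + b ^+ 2 <= M by rewrite /M; nra.
  have : 0 <= x ^+ 2 + y ^+ 2 by have := sqr_ge0 x; have := sqr_ge0 y; lra.
  nra.
rewrite !negb_or => /and3P[an0 anX bnY].
have ap : 0 < a by rewrite lt0r an0.
have ltaX : a < X by rewrite lt_neqAle anX.
have [bY1' bY2'] : - Y < b /\ b < Y.
  rewrite !lt_neqAle bY1 bY2 !andbT; split; apply: contra bnY => /eqP.
    by move=> <-; rewrite normrN gtr0_norm.
  by move=> ->; rewrite gtr0_norm.
have [a' [b' [c' T]]] := tf (Complex a b) ap.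
have a'0 : a' != 0 by rewrite -(taylor2_value T) f0.
have [B [r0 [B0 r00 mean]]] := taylor2_mean (taylor2_inv a'0 T).
(* Small enough for the mean value inequality to hold, for the four points to stay in the rectangle,
   and for B r <= d. *)
pose r := Num.min (Num.min (Num.min r0 a) (Num.min (X - a) (d / (B + 1))))
                  (Num.min (Y - b) (b + Y)).
have B1 : 0 < B + 1 by rewrite ltr_wpDl.
have rp : 0 < r.
  by rewrite /r !lt_min r00 ap divr_gt0 ?subr_gt0 ?ltaX ?bY2'//= -ltrBlDr sub0r.
have [[rr0 ra rX] [rB rb rb']] :
    [/\ r <= r0, r <= a & r <= X - a] /\ [/\ r <= d / (B + 1),
      r <= Y - b & r <= b + Y].
  have : r <= r by [].
  by rewrite {2}/r !le_min => /andP[/andP[/andP[? ?] /andP[? ?]] /andP[? ?]].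
have rBd : B * r <= d.
  have : r * (B + 1) <= d by rewrite -ler_pdivlMr.
  by apply: le_trans; rewrite mulrDr mulr1 mulrC lerDl ltW.
have /mean : 0 <= r <= r0 by rewrite ltW.
have -> : Complex a b + r%:C%C = Complex (a + r) b by rewrite /= /GRing.add/= addr0.
have -> : Complex a b - r%:C%C = Complex (a - r) b by rewrite /= /GRing.add/=
  oppr0 addr0.
have -> : Complex a b + 'i%C * r%:C%C = Complex a (b + r).
  by apply/eqP; rewrite eq_complex /=; apply/andP; split; apply/eqP; ring.
have -> : Complex a b - 'i%C * r%:C%C = Complex a (b - r).
  by apply/eqP; rewrite eq_complex /=; apply/andP; split; apply/eqP; ring.
have r0' := ltW rp.
have arX : a + r <= X by rewrite addrC -lerBrDr.
have ar0 : 0 <= a - r by rewrite subr_ge0.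
have brY : b + r <= Y by rewrite addrC -lerBrDr.
have brNY : - Y <= b - r by rewrite lerBrDl -lerBrDr opprK.
have arX' : a - r <= X by rewrite (le_trans _ aX)// gerBl.
have brNY' : - Y <= b + r by rewrite (le_trans bY1)// lerDl.
have brY' : b - r <= Y by rewrite (le_trans _ bY2)// gerBl.
have v1 := vle (a + r) b (addr_ge0 a0 r0') arX bY1 bY2.
have v2 := vle (a - r) b ar0 arX' bY1 bY2.
have v3 := vle a (b + r) a0 aX brNY' brY.
have v4 := vle a (b - r) a0 aX brNY brY'.
move: v1 v2 v3 v4.
rewrite /v /N /= !normcV !(ger0_norm a0) (ger0_norm ar0) (ger0_norm (addr_ge0 a0
  r0')).
move: (normc (f (Complex a b)))^-1 (normc (f (Complex (a + r) b)))^-1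
  (normc (f (Complex (a - r) b)))^-1 (normc (f (Complex a (b + r))))^-1
  (normc (f (Complex a (b - r))))^-1 => n0 n1 n2 n3 n4 v1 v2 v3 v4 mn.
(* Maximality at the four points gives 4 d r^2 plus their values of [N] <= 4 n0, and the mean
   inequality bounds 4 n0 by these values plus B r^3; so 4 d r^2 <= B r^3 <= d r^2, a
   contradiction. *)
have r3 : B * r ^+ 3 <= d * r ^+ 2.
  by rewrite exprSr mulrA mulrAC; apply: ler_wpM2r => //; exact: sqr_ge0.
have dr : 0 < d * r ^+ 2 by rewrite mulr_gt0 ?exprn_gt0.
exfalso; move: mn v1 v2 v3 v4 r3 dr; clear; rewrite !sqrrD sqrrN; lra.
Qed.

End MinimumModulus.

(** * Complex-valued integrals over [-1, 1] *)

Section ComplexIntegral.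
Context {R : realType}.
Notation mu := (@lebesgue_measure R).
Local Notation C := R[i].
Local Notation normc := (@normc R).
Local Notation I11 := (`[- 1 : R, 1]%classic).
Implicit Types (f g : R -> C) (c : C).

(** Stated by components because [Cintegral] is defined by components, so that the real lemmas apply
    to each. *)
Definition ccontinuous f :=
  continuous (fun z => complex.Re (f z)) /\ continuous (fun z => complex.Im (f z)).

Lemma ccontinuous_cst c : ccontinuous (fun _ => c).
Proof. by split=> z; exact: cvg_cst. Qed.

Lemma ccontinuous_real (f : R -> R) : continuous f -> ccontinuous (fun z =>
  (f z)%:C%C).
Proof. by move=> cf; split => z; [exact: cf|exact: cvg_cst]. Qed.

Lemma ReD (a b : C) : complex.Re (a + b) = complex.Re a + complex.Re b.
Proof. by case: a b => [? ?] []. Qed.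
Lemma ImD (a b : C) : complex.Im (a + b) = complex.Im a + complex.Im b.
Proof. by case: a b => [? ?] []. Qed.
Lemma ReM (a b : C) : complex.Re (a * b) =
  complex.Re a * complex.Re b - complex.Im a * complex.Im b.
Proof. by case: a b => [? ?] []. Qed.
Lemma ImM (a b : C) : complex.Im (a * b) =
  complex.Re a * complex.Im b + complex.Im a * complex.Re b.
Proof. by case: a b => [? ?] []. Qed.
Lemma ReV (a : C) : complex.Re a^-1 =
  complex.Re a / (complex.Re a ^+ 2 + complex.Im a ^+ 2).
Proof. by case: a. Qed.
Lemma ImV (a : C) : complex.Im a^-1 =
  - (complex.Im a / (complex.Re a ^+ 2 + complex.Im a ^+ 2)).
Proof. by case: a. Qed.

Lemma ccontinuousD f g : ccontinuous f -> ccontinuous g -> ccontinuous (fun z =>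
  f z + g z).
Proof.
move=> [f1 f2] [g1 g2]; split => z.
  under eq_fun do rewrite ReD; exact: cvgD (f1 z) (g1 z).
under eq_fun do rewrite ImD; exact: cvgD (f2 z) (g2 z).
Qed.

Lemma ccontinuousM f g : ccontinuous f -> ccontinuous g -> ccontinuous (fun z =>
  f z * g z).
Proof.
move=> [f1 f2] [g1 g2]; split => z.
  under eq_fun do rewrite ReM.
  exact: cvgB (cvgM (f1 z) (g1 z)) (cvgM (f2 z) (g2 z)).
under eq_fun do rewrite ImM.
exact: cvgD (cvgM (f1 z) (g2 z)) (cvgM (f2 z) (g1 z)).
Qed.

Lemma ccontinuousV f : (forall z, f z != 0) -> ccontinuous f ->
  ccontinuous (fun z => (f z)^-1).
Proof.
move=> f0 [f1 f2].
have n0 z : complex.Re (f z) ^+ 2 + complex.Im (f z) ^+ 2 != 0.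
  apply: contra (f0 z); case: (f z) => a b /=.
  by rewrite paddr_eq0 ?sqr_ge0// !sqrf_eq0 eq_complex.
have cn z : {for z, continuous (fun s =>
  (complex.Re (f s) ^+ 2 + complex.Im (f s) ^+ 2)^-1)}.
  by apply: cvgV => //; apply: cvgD; apply: cvgM; solve [exact: f1|exact: f2].
split => z.
  under eq_fun do rewrite ReV.
  exact: cvgM (f1 z) (cn z).
under eq_fun do rewrite ImV.
exact: cvgN (cvgM (f2 z) (cn z)).
Qed.

Local Notation CI := (Cintegral mu I11).

Lemma Cintegral_eq f g : (forall z, z \in `[- 1, 1] -> f z = g z) -> CI f = CI g.
Proof.
move=> fg; rewrite /Cintegral; congr Complex; apply: eq_Rintegral => z;
  by rewrite inE/= => /fg ->.
Qed.

Lemma CintegralD f g : ccontinuous f -> ccontinuous g ->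
  CI (fun z => f z + g z) = CI f + CI g.
Proof.
move=> [f1 f2] [g1 g2]; rewrite /Cintegral /GRing.add/=; congr Complex.
  under eq_Rintegral do rewrite ReD.
  by rewrite RintegralD//; exact: itv11_integrable.
under eq_Rintegral do rewrite ImD.
by rewrite RintegralD//; exact: itv11_integrable.
Qed.

Lemma CintegralZ c f : ccontinuous f -> CI (fun z => c * f z) = c * CI f.
Proof.
case: c => a b [f1 f2]; rewrite /Cintegral.
have ai1 := itv11_integrable f1; have ai2 := itv11_integrable f2.
have ci (r : R) (g : R -> R) : continuous g -> continuous (fun z => r * g z).
  by move=> cg z; apply: cvgM; [exact: cvg_cst|exact: cg].
apply/eqP; rewrite eq_complex; apply/andP; split; apply/eqP => /=.
  under eq_Rintegral do rewrite ReM/=.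
  rewrite RintegralB//; [|by apply: itv11_integrable; exact: ci..].
  by rewrite !RintegralZl.
under eq_Rintegral do rewrite ImM/=.
rewrite RintegralD//; [|by apply: itv11_integrable; exact: ci..].
by rewrite !RintegralZl.
Qed.

(** The factor 4 comes from bounding the real and the imaginary part separately on an interval of
    length 2. *)
Lemma normc_Cintegral f (M : R) : ccontinuous f ->
  (forall z, z \in `[- 1, 1] -> normc (f z) <= M) -> normc (CI f) <= 4 * M.
Proof.
move=> [f1 f2] fM.
have -> : 4 * M = M * (1 - (-1)) + M * (1 - (-1)) by ring.
apply: le_trans (normc_le_ReIm _) _; apply: lerD; apply: Rintegral_le_bound.
- lra.
- by move=> z _; exact: f1.
- by move=> z /fM; apply: le_trans; exact: normc_ge_Re.
- lra.
- by move=> z _; exact: f2.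
- by move=> z /fM; apply: le_trans; exact: normc_ge_Im.
Qed.

End ComplexIntegral.

(** * Taylor expansion and decay of the transform *)

Section LaplaceComplex.
Context {R : realType}.
Notation mu := (@lebesgue_measure R).
Local Notation C := R[i].
Local Notation normc := (@normc R).
Local Notation I11 := (`[- 1 : R, 1]%classic).
Local Notation CI := (Cintegral mu I11).
Implicit Types (l h : C).

Definition lap l : C := Complex (lap_re (complex.Re l) (complex.Im l))
                                (lap_im (complex.Re l) (complex.Im l)).

Definition pole l (z : R) : C := l + 'i%C * z%:C%C.

Lemma Re_pole l z : complex.Re (pole l z) = complex.Re l.
Proof. by case: l => a b /=; ring. Qed.

Lemma Im_pole l z : complex.Im (pole l z) = complex.Im l + z.
Proof. by case: l => a b /=; ring. Qed.

Lemma pole_ge l z : complex.Re l <= normc (pole l z).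
Proof. by rewrite -(Re_pole l z); apply: le_trans (normc_ge_Re _);
  exact: ler_norm. Qed.

Lemma pole_neq0 l z : 0 < complex.Re l -> pole l z != 0.
Proof. by move=> l0; rewrite -normc_gt0; apply: lt_le_trans (pole_ge l z). Qed.

Lemma poleV_ccontinuous l : 0 < complex.Re l -> ccontinuous (fun z =>
  (pole l z)^-1).
Proof.
move=> l0; apply: ccontinuousV => [z|]; first exact: pole_neq0.
apply: ccontinuousD; first exact: ccontinuous_cst.
apply: ccontinuousM; first exact: ccontinuous_cst.
by apply: ccontinuous_real => z; exact: cvg_id.
Qed.

Lemma weight_ccontinuous : ccontinuous (fun z : R => (weight z)%:C%C).
Proof. by apply: ccontinuous_real; exact: weight_continuous. Qed.

Lemma lapE l : 0 < complex.Re l -> lap l = CI (fun z =>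
  (weight z)%:C%C * (pole l z)^-1).
Proof.
move=> l0; rewrite /lap lap_reE// lap_imE// /Cintegral; congr Complex.
  by apply: eq_Rintegral => z _; rewrite ReM ReV ImV Re_pole Im_pole /=; ring.
rewrite -[LHS]mulN1r -RintegralZl//; last first.
  apply: itv11_integrable; rewrite /weight.
  move=> z; eapply D_continuous; derive_rule;
    rewrite gt_eqF// ltr_pwDl ?sqr_ge0 ?exprn_gt0//.
by apply: eq_Rintegral => z _; rewrite ImM ReV ImV Re_pole Im_pole /=; ring.
Qed.

(** Integrates 1/(p + h) = 1/p - h/p^2 + h^2/p^3 - h^3/(p^3 (p + h)) against the weight, with p = l
    + i z. For |h| <= Re l / 2, the denominators satisfy |p| >= Re l and |p + h| >= Re l / 2. *)
Lemma lap_taylor2 l : 0 < complex.Re l -> exists a b c, taylor2 lap l a b c.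
Proof.
move=> l0.
pose m n z : C := (weight z)%:C%C * (pole l z)^-1 ^+ n.
have cm n : ccontinuous (m n).
  apply: ccontinuousM; first exact: weight_ccontinuous.
  elim: n => [|n ih]; first exact: ccontinuous_cst.
  under eq_fun do rewrite exprS.
  by apply: ccontinuousM => //; exact: poleV_ccontinuous.
exists (CI (m 1%N)), (- CI (m 2%N)), (CI (m 3%N)).
set x := complex.Re l in l0.
exists (4 * ((x^-1) ^+ 3 * (x / 2)^-1)), (x / 2); split.
- by rewrite !mulr_ge0 ?exprn_ge0 ?invr_ge0 ?mulr_ge0 ?invr_ge0// ltW.
- by rewrite divr_gt0.
move=> h hx.
have lh : x / 2 <= complex.Re (l + h).
  rewrite ReD -/x; have := le_trans (normc_ge_Re h) hx.
  by rewrite ler_norml => /andP[]; lra.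
have lh0 : 0 < complex.Re (l + h) by apply: lt_le_trans lh; rewrite divr_gt0.
pose rho z : C := - h ^+ 3 * (m 3%N z * (pole (l + h) z)^-1).
have cr : ccontinuous (fun z => m 3%N z * (pole (l + h) z)^-1).
  by apply: ccontinuousM => //; exact: poleV_ccontinuous.
have -> : lap (l + h) - (CI (m 1%N) + - CI (m 2%N) * h + CI (m 3%N) * h ^+ 2) =
    - h ^+ 3 * CI (fun z => m 3%N z * (pole (l + h) z)^-1).
  rewrite lapE//.
  have -> : CI (fun z => (weight z)%:C%C * (pole (l + h) z)^-1) =
    CI (fun z => (1 * m 1%N z + - h * m 2%N z) + (h ^+ 2 * m 3%N z +
        - h ^+ 3 * (m 3%N z * (pole (l + h) z)^-1))).
    apply: Cintegral_eq => z _; rewrite /m.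
    have := pole_neq0 z l0; have := pole_neq0 z lh0.
    have -> : pole (l + h) z = pole l z + h by rewrite /pole addrAC.
    by move: (pole l z) => p p0 p1; field; rewrite p0 p1.
  have cZ c (f : R -> C) : ccontinuous f -> ccontinuous (fun z => c * f z).
    by apply: ccontinuousM; exact: ccontinuous_cst.
  have c1 := cZ 1 _ (cm 1%N); have c2 := cZ (- h) _ (cm 2%N).
  have c3 := cZ (h ^+ 2) _ (cm 3%N); have c4 := cZ (- h ^+ 3) _ cr.
  rewrite (CintegralD (ccontinuousD c1 c2) (ccontinuousD c3 c4)).
  rewrite (CintegralD c1 c2) (CintegralD c3 c4).
  rewrite (CintegralZ _ (cm 1%N)) (CintegralZ _ (cm 2%N)) (CintegralZ _ (cm 3%N)).
  rewrite (CintegralZ _ cr); ring.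
rewrite normcM normc_opp normcX mulrC; apply: ler_wpM2r;
  first by rewrite exprn_ge0// normc_ge0.
apply: normc_Cintegral => // z z1; rewrite (normcM (m 3%N z)); apply: ler_pM.
- exact: normc_ge0.
- exact: normc_ge0.
- rewrite /m normcM -[leRHS]mul1r; apply: ler_pM; rewrite ?normc_ge0//.
    by rewrite normc_real weight_le1.
  rewrite normcX normcV; apply: lerXn2r;
    rewrite ?nnegrE ?invr_ge0 ?normc_ge0 ?(ltW l0)//.
  by rewrite lef_pV2 ?posrE ?normc_gt0 ?pole_neq0// pole_ge.
- rewrite normcV lef_pV2 ?posrE ?normc_gt0 ?pole_neq0 ?divr_gt0//.
  exact: le_trans lh (pole_ge _ _).
Qed.

Lemma lap_bound l (M : R) : 0 < complex.Re l -> 0 < M ->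
  (forall z, z \in `[- 1, 1] -> M <= normc (pole l z)) -> normc (lap l) <= 4 / M.
Proof.
move=> l0 M0 lM; rewrite lapE//; apply: normc_Cintegral.
  by apply: ccontinuousM; [exact: weight_ccontinuous|exact: poleV_ccontinuous].
move=> z z1; rewrite normcM -[leRHS]mul1r; apply: ler_pM; rewrite ?normc_ge0//.
  by rewrite normc_real weight_le1.
by rewrite normcV lef_pV2 ?posrE ?normc_gt0 ?pole_neq0// lM.
Qed.

End LaplaceComplex.

(** * Values on the imaginary axis and the principal value *)

Section BoundaryValues.
Context {R : realType}.
Notation mu := (@lebesgue_measure R).
Implicit Types (x y z t : R).
Local Notation I11 := (`[- 1 : R, 1]%classic).
Local Notation w := (@weight R).

(** [sqA + i sqB] is the polynomial [weight] evaluated at - y + i x, the zero in z of x + i (y +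
    z). *)
Let sqA x y : R := y ^+ 2 - x ^+ 2 - (y ^+ 2 - x ^+ 2) ^+ 2 + 4 * x ^+ 2 * y ^+ 2.
Let sqB x y : R := 4 * x * y * (y ^+ 2 - x ^+ 2) - 2 * x * y.
(** [darg - i dlog] is the integral of 1 / (x + i (y + z)) over [-1, 1]. *)
Let darg x y : R := atan ((y + 1) / x) - atan ((y - 1) / x).
Let dlog x y : R := (ln (x ^+ 2 + (y + 1) ^+ 2) - ln (x ^+ 2 + (y - 1) ^+ 2)) / 2.

(* polynomial division of [weight z] by [x + i (y + z)] *)
Lemma lap_re_closed x y : 0 < x -> lap_re x y =
  sqA x y * darg x y + sqB x y * dlog x y + (4 / 3 * x - 6 * x * y ^+ 2 + 2 * x
    ^+ 3).
Proof.
move=> x0; rewrite lap_reE//.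
have q0 z : 0 < x ^+ 2 + (y + z) ^+ 2 by exact: sqr_sum_gt0.
rewrite (Rintegral_FTC (F := fun z => sqA x y * atan ((y + z) / x) +
  sqB x y * (ln (x ^+ 2 + (y + z) ^+ 2) / 2) +
  (x * z - z ^+ 3 * (x / 3) + x * y * z ^+ 2 - (3 * x * y ^+ 2 - x ^+ 3) * z))).
- by rewrite /darg /dlog; field.
- lra.
- move=> z _; rewrite /w; eapply D_continuous; derive_rule; by rewrite gt_eqF.
- move=> z _; rewrite /w /sqA /sqB; derive => //=.
  by field; rewrite !gt_eqF//= addrC.
Qed.

Lemma lap_im_closed x y : 0 < x -> lap_im x y =
  sqB x y * darg x y - sqA x y * dlog x y + (4 / 3 * y - 2 * y ^+ 3 + 6 * y * x
    ^+ 2).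
Proof.
move=> x0; rewrite lap_imE//; apply: oppr_inj; rewrite opprK.
have q0 z : 0 < x ^+ 2 + (y + z) ^+ 2 by exact: sqr_sum_gt0.
rewrite (Rintegral_FTC (F := fun z => - (sqB x y * atan ((y + z) / x) -
  sqA x y * (ln (x ^+ 2 + (y + z) ^+ 2) / 2)) +
  (z ^+ 2 / 2 - y * z - z ^+ 4 / 4 + z ^+ 3 * (y / 3) - z ^+ 2 * ((y ^+ 2 - x ^+
    2) / 2) -
   (3 * y * x ^+ 2 - y ^+ 3) * z))).
- by rewrite /darg /dlog; field.
- lra.
- move=> z _; rewrite /w; eapply D_continuous; derive_rule; by rewrite gt_eqF.
- move=> z _; rewrite /w /sqA /sqB; derive => //=.
  by field; rewrite !gt_eqF//= addrC.
Qed.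

Let holder_continuous (f : R -> R -> R) :
  (forall x y x' y', 0 <= x -> 0 <= x' -> `|f x y - f x' y'| <=
     @holder_const R * Num.sqrt (2 * (`|x - x'| + `|y - y'|))) ->
  continuous (fun p : R * R => f `|p.1| p.2).
Proof.
set H := @holder_const R; move=> fh p; apply/cvgrPdist_le => /= e e0.
have H0 := (@holder_const_ge0 R).
have H1 : 0 < H + 1 by rewrite ltr_wpDl.
(* Chosen so that sqrt (2 (d + d)) = e / (H + 1); the 1 guards against H = 0. *)
pose d := (e / (H + 1)) ^+ 2 / 4.
have d0 : 0 < d by rewrite divr_gt0// exprn_gt0// divr_gt0.
have pq : \forall q \near p, `|p.1 - q.1| < d /\ `|p.2 - q.2| < d.
  by apply/nbhs_ballP; exists d => // q [].
near=> q; have [q1 q2] : `|p.1 - q.1| < d /\ `|p.2 - q.2| < d by near: q.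
apply: le_trans (fh _ _ _ _ _ _) _; rewrite ?normr_ge0//.
apply: (@le_trans _ _ (H * (e / (H + 1)))); last first.
  rewrite mulrCA ler_piMr ?(ltW e0)// ler_pdivrMr// mul1r lerDl//.
apply: ler_wpM2l => //.
have ee : 0 <= e / (H + 1) by rewrite divr_ge0// ltW.
rewrite -[leRHS](ger0_norm ee) -(sqrtr_sqr (e / (H + 1))); apply: ler_wsqrtr.
have -> : (e / (H + 1)) ^+ 2 = 2 * (d + d) by rewrite /d; field; lra.
apply: ler_wpM2l => //; apply: lerD; apply: ltW => //.
exact: le_lt_trans (ler_dist_dist _ _) q1.
Unshelve. all: by end_near. Qed.

Lemma lap_re_continuous : continuous (fun p : R * R => lap_re `|p.1| p.2).
Proof. by apply: holder_continuous => *; exact: lap_re_holder. Qed.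

Lemma lap_im_continuous : continuous (fun p : R * R => lap_im `|p.1| p.2).
Proof. by apply: holder_continuous => *; exact: lap_im_holder. Qed.

(** Carries formulas and inequalities known for x > 0 over to x = 0. *)
Let cvg_at_boundary (f : R -> R -> R) y :
  continuous (fun p : R * R => f `|p.1| p.2) -> f x y @[x --> 0^'+] --> f 0 y.
Proof.
move=> cf.
have h : f `|x| y @[x --> 0^'+] --> f 0 y.
  rewrite -[X in _ --> f X y](normr0 R); apply: cvg_at_right_filter.
  apply: (@cvg_comp _ _ _ (fun x : R => (x, y)) (fun p : R * R =>
    f `|p.1| p.2) _ (nbhs ((0 : R), y))).
    by apply: (@cvg_pair _ _ _ _ (nbhs (0 : R)) (nbhs y));
      [exact: cvg_id|exact: cvg_cst].
  exact: (cf (0, y)).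
apply: cvg_trans h; apply: near_eq_cvg; near=> x.
by rewrite ger0_norm.
Unshelve. all: by end_near. Qed.

Let cvgy_div c : 0 < c -> c / x @[x --> (0 : R)^'+] --> +oo%R.
Proof.
move=> c0; apply/gtr0_cvgV0.
  by near=> x; rewrite divr_gt0.
have h : c^-1 * x @[x --> 0^'+] --> c^-1 * 0.
  by apply: cvgM; [exact: cvg_cst|apply: cvg_at_right_filter; exact: cvg_id].
rewrite mulr0 in h; apply: cvg_trans h; apply: near_eq_cvg; near=> x.
by rewrite /= invf_div mulrC.
Unshelve. all: by end_near. Qed.

(** As y + 1 > 0 > y - 1, the arctangents tend to pi/2 and - pi/2. This is the source of the
    half-residue pi w y on the imaginary axis. *)
Let cvg_darg y : - 1 < y < 1 -> darg x y @[x --> 0^'+] --> (pi : R).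
Proof.
move=> /andP[y1 y2].
have -> : (fun x => darg x y) = (fun x => atan ((y + 1) / x) + atan ((1 - y) / x)).
  by apply/funext => x; rewrite /darg -atanN -mulNr opprB.
rewrite (splitr pi); apply: cvgD.
  apply: (@cvg_comp _ _ _ (fun x : R => (y + 1) / x) (@atan R) _ +oo%R);
    last exact: cvgy_atan.
  by apply: cvgy_div; lra.
apply: (@cvg_comp _ _ _ (fun x : R => (1 - y) / x) (@atan R) _ +oo%R);
  last exact: cvgy_atan.
by apply: cvgy_div; lra.
Qed.

(** For |y| < 1, the principal value of the integral of 1 / (y + z) over [-1, 1]. *)
Definition dlog0 y : R := ln ((1 + y) / (1 - y)).

Let cvg_dlog y : - 1 < y < 1 -> dlog x y @[x --> 0^'+] --> dlog0 y.
Proof.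
move=> /andP[y1 y2].
have y1' : 0 < 1 + y by lra.
have y2' : 0 < 1 - y by lra.
have -> : dlog0 y = dlog 0 y.
  rewrite /dlog0 /dlog ln_div// expr0n/= !add0r (_ :
    (y - 1) ^+ 2 = (1 - y) ^+ 2); last by ring.
  by rewrite (addrC y 1) !expr2 !lnM ?posrE//; [field|lra..].
have cd u : u = 0 -> {for u, continuous (fun x => dlog x y)}.
  move=> u0; rewrite /dlog; eapply D_continuous; derive_rule;
    by rewrite u0 expr0n/= add0r exprn_even_gt0//=; lra.
by apply: cvg_at_right_filter; exact: (cd 0 erefl).
Qed.

Let cvg_poly (f : R -> R) (a : R) : continuous f -> f 0 = a ->
  f x @[x --> 0^'+] --> a.
Proof. by move=> cf <-; apply: cvg_at_right_filter; exact: cf. Qed.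

(* closed form of the principal value of [weight z / (y + z)] over [[-1, 1]] *)
Definition weight_PV y : R := w y * dlog0 y - (4 / 3 * y - 2 * y ^+ 3).

Lemma lap_re_boundary y : - 1 < y < 1 -> lap_re 0 y = pi * w y.
Proof.
move=> y1; apply: (@cvg_unique _ _ (lap_re x y @[x --> 0^'+])) => //.
  exact: cvg_at_boundary lap_re_continuous.
have h : sqA x y * darg x y + sqB x y * dlog x y + (4 / 3 * x - 6 * x * y ^+ 2 +
  2 * x ^+ 3)
    @[x --> 0^'+] --> w y * pi + 0 * dlog0 y + 0.
  apply: cvgD; first (apply: cvgD; apply: cvgM).
  - by apply: cvg_poly; rewrite /sqA ?/w; [cont|ring].
  - exact: cvg_darg.
  - by apply: cvg_poly; rewrite /sqB; [cont|ring].
  - exact: cvg_dlog.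
  - by apply: cvg_poly; [cont|ring].
have -> : pi * w y = w y * pi + 0 * dlog0 y + 0 by ring.
apply: cvg_trans h; apply: near_eq_cvg; near=> x.
by rewrite lap_re_closed.
Unshelve. all: by end_near. Qed.

Lemma lap_im_boundary y : - 1 < y < 1 -> lap_im 0 y = - weight_PV y.
Proof.
move=> y1; apply: (@cvg_unique _ _ (lap_im x y @[x --> 0^'+])) => //.
  exact: cvg_at_boundary lap_im_continuous.
have h : sqB x y * darg x y - sqA x y * dlog x y + (4 / 3 * y - 2 * y ^+ 3 + 6 *
  y * x ^+ 2)
    @[x --> 0^'+] --> 0 * pi - w y * dlog0 y + (4 / 3 * y - 2 * y ^+ 3).
  apply: cvgD; first (apply: cvgB; apply: cvgM).
  - by apply: cvg_poly; rewrite /sqB; [cont|ring].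
  - exact: cvg_darg.
  - by apply: cvg_poly; rewrite /sqA ?/w; [cont|ring].
  - exact: cvg_dlog.
  - by apply: cvg_poly; [cont|ring].
have -> : - weight_PV y = 0 * pi - w y * dlog0 y + (4 / 3 * y - 2 * y ^+ 3).
  by rewrite /weight_PV; ring.
apply: cvg_trans h; apply: near_eq_cvg; near=> x.
by rewrite lap_im_closed.
Unshelve. all: by end_near. Qed.

(** For x > 0 the integrand is the weight times a Poisson kernel, hence nonnegative; x = 0 follows
    by passing to the limit. *)
Lemma lap_re_ge0 x y : 0 <= x -> 0 <= lap_re x y.
Proof.
have pos s : 0 < s -> 0 <= lap_re s y.
  move=> s0; rewrite lap_reE//; apply: Rintegral_ge0 => z z1.
  apply: mulr_ge0; first exact: weight_ge0.
  by rewrite divr_ge0 ?(ltW s0)// ltW// sqr_sum_gt0.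
rewrite le_eqVlt => /predU1P[<-|/pos//].
apply: (cvgr_to_ge (cvg_at_boundary (y := y) lap_re_continuous)).
by near=> s; apply: pos.
Unshelve. all: by end_near. Qed.

(* for [|y| >= 1] the factor [y + z] has constant sign *)
Lemma lap_im_boundary_ge1 y : 1 <= y -> lap_im 0 y < 0.
Proof.
move=> y1.
(* A lower bound of - lap_im x y uniform in 0 < x <= 1, so that strict negativity survives the
   limit; 4/15 is the integral of [w]. *)
pose c := (4 / 15 * y) / (1 + (y + 1) ^+ 2).
have q0 : 0 < 1 + (y + 1) ^+ 2 by rewrite ltr_wpDr ?sqr_ge0.
have c0 : 0 < c by rewrite divr_gt0// mulr_gt0//; lra.
suff : lap_im 0 y <= - c by lra.
apply: (cvgr_to_le (cvg_at_boundary (y := y) lap_im_continuous)).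
near=> x.
have x0 : 0 < x by [].
have x1 : x <= 1 by near: x; apply: nbhs_right_le.
have q1 z : 0 < x ^+ 2 + (y + z) ^+ 2 by exact: sqr_sum_gt0.
rewrite lap_imE// lerN2.
have -> : c = \int[mu]_(z in I11) (w z * ((y + z) / (1 + (y + 1) ^+ 2))).
  rewrite (Rintegral_FTC (F := fun z =>
    (y * (z ^+ 3 / 3 - z ^+ 5 / 5) + (z ^+ 4 / 4 - z ^+ 6 / 6)) / (1 + (y + 1) ^+
    2))).
  - by rewrite /c; field; rewrite gt_eqF.
  - lra.
  - by move=> z _; move: z; rewrite /w; cont.
  - by move=> z _; rewrite /w; derive; rewrite /=; field; rewrite gt_eqF.
apply: le_Rintegral => //.
- by apply: itv11_integrable; rewrite /w; cont.
- apply: itv11_integrable; rewrite /w => z; eapply D_continuous; derive_rule.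
  by rewrite gt_eqF.
move=> z z1; apply: ler_wpM2l; first exact: weight_ge0.
move: z1; rewrite /= in_itv/= => /andP[z1 z2].
apply: ler_wpM2l; first lra.
by rewrite lef_pV2 ?posrE//; nra.
Unshelve. all: by end_near. Qed.

End BoundaryValues.

(** * The principal value and its zero *)

Section PrincipalValue.
Context {R : realType}.
Notation mu := (@lebesgue_measure R).
Implicit Types (b x y z t : R).
Local Notation w := (@weight R).

(** An antiderivative of the polynomial (w z - w b) / (b + z), the regular part of the integrand;
    the singular part is w b / (b + z), as w is even. *)
Let Q b z : R := z ^+ 2 / 2 - b * z - z ^+ 4 / 4 + b * z ^+ 3 / 3
  - b ^+ 2 * z ^+ 2 / 2 + b ^+ 3 * z.

Let f b z : R := z ^+ 2 * (1 - z ^+ 2) / (b + z).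

Let left_part b c : - 1 <= c -> c < - b ->
  \int[mu]_(z in `[- 1, c]) f b z =
  w b * (ln (- b - c) - ln (1 - b)) + (Q b c - Q b (- 1)).
Proof.
move=> c1 cb; have bz z : z \in `[- 1, c] -> 0 < - b - z.
  by rewrite in_itv/= => /andP[]; lra.
have bz0 z : z \in `[- 1, c] -> b + z != 0.
  by move=> /bz h; rewrite lt_eqF//; lra.
rewrite (@Rintegral_FTC _ (f b) (fun z => w b * ln (- b - z) + Q b z)).
- rewrite opprK (addrC (- b) 1); ring.
- by [].
- by move=> z zc; rewrite /f; eapply D_continuous; derive_rule; exact: bz0.
- move=> z zc; rewrite /Q /w /f; derive; first exact: bz.
  by rewrite /=; field; rewrite bz0// gt_eqF// bz.
Qed.

Let right_part b c : c <= 1 -> - b < c ->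
  \int[mu]_(z in `[c, 1]) f b z =
  w b * (ln (1 + b) - ln (b + c)) + (Q b 1 - Q b c).
Proof.
move=> c1 cb; have bz z : z \in `[c, 1] -> 0 < b + z.
  by rewrite in_itv/= => /andP[]; lra.
have bz0 z : z \in `[c, 1] -> b + z != 0.
  by move=> /bz h; rewrite gt_eqF//; lra.
rewrite (@Rintegral_FTC _ (f b) (fun z => w b * ln (b + z) + Q b z)).
- rewrite (addrC b 1); ring.
- by [].
- by move=> z zc; rewrite /f; eapply D_continuous; derive_rule; exact: bz0.
- move=> z zc; rewrite /Q /w /f; derive; first exact: bz.
  by rewrite /=; field; rewrite bz0.
Qed.

(** Since the excision is symmetric about - b, the terms w b ln eta of the two sides cancel; what
    remains is continuous in eta, down to eta = 0. *)
Lemma weight_is_PV b : 0 < b < 1 ->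
  is_PV (fun z => z ^+ 2 * (1 - z ^+ 2) / (b + z)) (- 1) 1 (- b) (weight_PV b).
Proof.
move=> /andP[b0 b1]; rewrite /is_PV.
have -> : weight_PV b = w b * (ln (1 + b) - ln (1 - b)) + (Q b 1 - Q b (- b + 0))
  + (Q b (- b - 0) - Q b (- 1)).
  by rewrite /weight_PV /dlog0 ln_div ?posrE /Q; [field|lra..].
have h : w b * (ln (1 + b) - ln (1 - b)) + (Q b 1 - Q b (- b + eta)) + (Q b (- b
  - eta) - Q b (- 1))
    @[eta --> 0^'+] --> w b * (ln (1 + b) - ln (1 - b)) + (Q b 1 - Q b (- b + 0))
      + (Q b (- b - 0) - Q b (- 1)).
  apply: cvg_at_right_filter.
  have ce : continuous (fun eta : R =>
    w b * (ln (1 + b) - ln (1 - b)) + (Q b 1 - Q b (- b + eta)) + (Q b (- b -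
    eta) - Q b (- 1))).
    by rewrite /Q; cont.
  exact: ce.
apply: cvg_trans h; apply: near_eq_cvg; near=> eta.
have e0 : 0 < eta by [].
have eb : eta < 1 - b by near: eta; apply: nbhs_right_lt; lra.
have l1 : - 1 <= - b - eta by lra.
have l2 : - b - eta < - b by lra.
have r1 : - b + eta <= 1 by lra.
have r2 : - b < - b + eta by lra.
have -> : `[-1, 1]%classic `\` `](- b - eta), (- b + eta)[%classic =
    `[- 1, - b - eta]%classic `|` `[- b + eta, 1]%classic :> set R.
  apply/seteqP; split => z; rewrite /= !in_itv/=.
    case=> /andP[z1 z2] /negP; rewrite negb_and -!leNgt => /orP[h|h].
      by left; rewrite z1 h.
    by right; rewrite h z2.
  case=> /andP[z1 z2]; split; try (apply/andP; split; lra); apply/negP;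
    rewrite negb_and -!leNgt.
    by rewrite z2.
  by rewrite z1 orbT.
rewrite Rintegral_setU//.
- rewrite left_part// right_part//.
  have -> : - b - (- b - eta) = eta by ring.
  have -> : b + (- b + eta) = eta by ring.
  ring.
- apply: continuous_compact_integrable.
    by apply: compactU; exact: segment_compact.
  apply: continuous_in_subspaceT => z /set_mem[]; rewrite /= in_itv/= => /andP[? ?];
    eapply D_continuous; derive_rule.
    by rewrite lt_eqF//; lra.
  by rewrite gt_eqF//; lra.
- apply/disj_setPS => z [] /=; rewrite !in_itv/= => /andP[? ?] /andP[? ?]; lra.
Unshelve. all: by end_near. Qed.

(** [weight_PV] divided by w y > 0: the logarithm loses its coefficient, so the derivative is
    rational, and it is positive. Uniqueness of the zero follows. *)
Let hr y : R := dlog0 y - (4 / 3 - 2 * y ^+ 2) / (y * (1 - y ^+ 2)).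

Let weight_PV_hr y : 0 < y < 1 -> weight_PV y = y ^+ 2 * (1 - y ^+ 2) * hr y.
Proof.
move=> /andP[y0 y1]; rewrite /weight_PV /w /hr.
have y2 : 1 - y ^+ 2 != 0 by rewrite gt_eqF//; nra.
by field; rewrite y2 gt_eqF.
Qed.

Let D_hr y : 0 < y < 1 -> has_derive hr y (4 / 3 / (y * (1 - y ^+ 2)) ^+ 2).
Proof.
move=> /andP[y0 y1]; have y2 : 0 < 1 - y ^+ 2 by nra.
rewrite /hr /dlog0; derive.
- by rewrite divr_gt0//; lra.
- by rewrite gt_eqF//; lra.
- by rewrite mulf_neq0// gt_eqF.
- rewrite /=; field; rewrite ?gt_eqF//=; lra.
Qed.

Let hr_increasing x y : 0 < x -> x < y -> y < 1 -> hr x < hr y.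
Proof.
move=> x0 xy y1.
have sub c : c \in `[x, y] -> 0 < c < 1.
  by rewrite in_itv/= => /andP[? ?]; apply/andP; split; lra.
have [c cxy e] :
    exists2 c, c \in `]x, y[%R & hr y - hr x = 4 / 3 / (c * (1 - c ^+ 2)) ^+ 2 * (y - x).
  apply: (MVT (df := fun c => 4 / 3 / (c * (1 - c ^+ 2)) ^+ 2)) =>
    // [c /subset_itv_oo_cc/sub|].
    exact: D_hr.
  apply: continuous_in_subspaceT => c /[!inE] /sub h;
    exact: (D_continuous (D_hr h)).
have /andP[c0 c1] := sub c (subset_itv_oo_cc cxy).
have c2 : 0 < 1 - c ^+ 2 by nra.
rewrite -subr_gt0 e mulr_gt0 ?subr_gt0// divr_gt0// exprn_gt0// mulr_gt0//.
Qed.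

(** [b_c] is a choice among points where the principal value converges to 0. Uniqueness of limits
    turns this into [weight_PV] being zero, and strict monotonicity of [hr] leaves one candidate. *)
Lemma b_c_spec : [/\ 0 < b_c R < 1, weight_PV (b_c R) = 0 &
  forall y, 0 < y < 1 -> weight_PV y = 0 -> y = b_c R].
Proof.
have hr0 y : 0 < y < 1 -> weight_PV y = 0 -> hr y = 0.
  move=> y01; rewrite weight_PV_hr// => /eqP.
  have /andP[y0 y1] := y01.
  by rewrite mulf_eq0 gt_eqF/= => [/eqP//|]; rewrite mulr_gt0 ?exprn_gt0//; nra.
have uniq y z : 0 < y < 1 -> 0 < z < 1 -> weight_PV y = 0 -> weight_PV z = 0 ->
  y = z.
  move=> y01 z01 /(hr0 _ y01) hy /(hr0 _ z01) hz.
  have /andP[y0 y1] := y01; have /andP[z0 z1] := z01.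
  by case: (ltgtP y z) => // h; [have := hr_increasing y0 h z1|have :=
    hr_increasing z0 h y1];
    rewrite hy hz ltxx.
have [c c01 hc] : exists2 c : R, 0 < c < 1 & weight_PV c = 0.
  have sub (c : R) : c \in `[2^-1, 9 / 10] -> 0 < c < 1.
    by rewrite in_itv/= => /andP[? ?]; apply/andP; split; lra.
  have [c /sub c01 hc] : exists2 c : R, c \in `[2^-1, 9 / 10] & hr c = 0.
    apply: IVT; first lra.
      apply: continuous_in_subspaceT => c /[!inE] /sub h;
        exact: (D_continuous (D_hr h)).
    (* At 1/2, ln 3 <= 2 < 20/9. At 9/10 the numerator 4/3 - 2 y^2 is negative and the logarithm
       nonnegative. *)
    rewrite ge_min le_max; apply/andP; split; apply/orP; [left|right].
      rewrite /hr /dlog0.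
      have -> : (1 + 2^-1) / (1 - 2^-1) = 1 + 2 :> R by field.
      have := @le_ln1Dx R 2 ltac:(lra).
      have -> : (4 / 3 - 2 * 2^-1 ^+ 2) / (2^-1 * (1 - 2^-1 ^+ 2)) = 20 / 9 :> R
        by field.
      lra.
    rewrite /hr subr_ge0; apply: (@le_trans _ _ 0).
      by rewrite mulr_le0_ge0 ?invr_ge0//; lra.
    by apply: ln_ge0; rewrite ler_pdivlMr; lra.
  by exists c => //; rewrite weight_PV_hr// hc mulr0.
have PV0 y : 0 < y < 1 ->
    is_PV (fun z => z ^+ 2 * (1 - z ^+ 2) / (y + z)) (- 1) 1 (- y) 0 ->
      weight_PV y = 0.
  by move=> y01; apply: cvg_unique => //; exact: weight_is_PV.
have bE : b_c R = c.
  apply: xget_unique => [|y [y01 hy]].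
    by split => //; rewrite -hc; exact: weight_is_PV.
  by apply: uniq => //; exact: PV0.
by rewrite bE; split => // y y01 hy; exact: uniq.
Qed.

End PrincipalValue.

(** * The sphere integral *)

Section Kernel.
Context {R : realType}.
Notation mu := (@lebesgue_measure R).
Local Notation C := R[i].
Implicit Types (p : 'cV[R]_3) (i j : 'I_3) (t : R).

Lemma dot_delta (v : 'cV[C]_3) j : dot v (delta_mx j 0) = v j 0.
Proof.
rewrite /dot (bigD1 j)//= mxE !eqxx mulr1 big1 ?addr0// => l lj.
by rewrite mxE (negbTE lj) mulr0.
Qed.

Lemma dot_evec (v : 'cV[C]_3) : dot v (evec R) = v ord_max 0.
Proof. exact: dot_delta. Qed.

Lemma dotC (v w : 'cV[C]_3) : dot v w = dot w v.
Proof. by apply: eq_bigr => l _; rewrite mulrC. Qed.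

Lemma mul_evec m (A : 'M[C]_(m, 3)) (i : 'I_m) : (A *m evec R) i 0 = A i ord_max.
Proof. by rewrite /evec -colE mxE. Qed.

Lemma proj_mulE n (A : 'M[C]_(3, n)) i (j : 'I_n) : (proj_e_perp R *m A) i j =
  if i == ord_max then 0 else A i j.
Proof.
rewrite /proj_e_perp mulmxBl mul1mx /tensor /evec -mulmxA trmx_delta -rowE !mxE.
rewrite big_ord1 !mxE eqxx andbT; case: eqP => [->|_].
  by rewrite mul1r subrr.
by rewrite mul0r subr0.
Qed.

Lemma dot_L2bar (Gamma : R) p j : dot (L2bar Gamma p) (delta_mx j 0) =
  3 * 'i%C * Gamma%:C%C / (4 * pi%:C%C) * (p ord_max 0)%:C%C *
  (if j == ord_max then 0 else (p j 0)%:C%C).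
Proof.
rewrite dot_delta /L2bar mxE dot_evec proj_mulE !mxE; by [].
Qed.

Lemma tL1E t p : t%:C%C * L1 p = Complex 0 (- (t * p ord_max 0)).
Proof.
rewrite /L1 dotC dot_evec mxE.
by apply/eqP; rewrite eq_complex /=; apply/andP; split; apply/eqP; ring.
Qed.

Lemma Cexp_tL1 t p :
  Cexp (t%:C%C * L1 p) = Complex (cos (t * p ord_max 0)) (- sin (t * p ord_max 0)).
Proof.
rewrite tL1E /Cexp /= expR0 cosN sinN.
by apply/eqP; rewrite eq_complex /=; apply/andP; split; apply/eqP; ring.
Qed.

(** The substitution z = cos a absorbs the density sin a of the surface measure. *)
Lemma Rintegral_cos_subst (G : R -> R) : continuous G ->
  \int[mu]_(z in `[- 1, 1]) G z = \int[mu]_(a in `[0, pi]) (G (cos a) * sin a).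
Proof.
move=> cG; rewrite /Rintegral -cospi -{1}cos0.
have dcos : derive1 (@cos R) = (fun a => - sin a).
  by apply/funext => a; rewrite derive1E derive_val.
have cdcos : continuous (fun a : R => - sin a) by cont.
rewrite integration_by_substitution_decreasing//.
- congr fine; apply: eq_integral => a _.
  by rewrite fctE /= dcos fctE opprK.
- exact: pi_ge0.
- by move=> a b a0 b0 ab; rewrite ltr_cos.
- by rewrite dcos => a _; exact: cdcos.
- by rewrite dcos; apply: cvgP; apply: cvg_at_right_filter; exact: cdcos.
- by rewrite dcos; apply: cvgP; apply: cvg_at_left_filter; exact: cdcos.
- split.
  + by move=> a _; exact: ex_derive.
  + by apply: cvg_at_right_filter; exact: continuous_cos.
  + by apply: cvg_at_left_filter; exact: continuous_cos.
- by apply: continuous_subspaceT.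
Qed.

(* azimuthal factor of the projection of a point of the sphere on [e^perp] *)
Definition azimuth j (b : R) : R := [:: cos b; sin b; 0]`_j.

Lemma azimuth_moment i j : i != ord_max ->
  \int[mu]_(b in `[0, 2 * pi]) (azimuth i b * azimuth j b) = (i == j)%:R * pi.
Proof.
have c2 (b : R) : cos b ^+ 2 = 1 - sin b ^+ 2 by rewrite -(cos2Dsin2 b) addrK.
have pi2 : 0 <= 2 * pi :> R by rewrite mulr_ge0// pi_ge0.
have s2 : sin (2 * pi) = 0 :> R by rewrite mulr_natl sin2pi.
have FTC (f F : R -> R) : continuous f -> (forall b, has_derive F b (f b)) ->
    \int[mu]_(b in `[0, 2 * pi]) f b = F (2 * pi) - F 0.
  by move=> cf dF; apply: Rintegral_FTC => // b _; exact: cf.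
case: i => [[|[|[|//]]] Hi]; case: j => [[|[|[|//]]] Hj] //= _; rewrite /azimuth/=.
- rewrite (FTC _ (fun b => (b + sin b * cos b) / 2)); first
    by rewrite s2 sin0; field.
    by cont.
  by move=> b; derive; rewrite /=; have := c2 b; lra.
- rewrite (FTC _ (fun b => sin b ^+ 2 / 2)); first by rewrite s2 sin0; field.
    by cont.
  by move=> b; derive; rewrite /=; field.
- by rewrite (FTC _ (fun b => 0)) ?subrr ?mul0r//; [cont|move=> b; derive;
    rewrite mulr0].
- rewrite (FTC _ (fun b => sin b ^+ 2 / 2)); first by rewrite s2 sin0; field.
    by cont.
  by move=> b; derive; rewrite /=; field.
- rewrite (FTC _ (fun b => (b - sin b * cos b) / 2)); first
    by rewrite s2 sin0; field.
    by cont.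
  by move=> b; derive; rewrite /=; have := c2 b; lra.
- by rewrite (FTC _ (fun b => 0)) ?subrr ?mul0r//; [cont|move=> b; derive;
    rewrite mulr0].
Qed.

Lemma Rintegral_prod (a b c d : R) (g h : R -> R) : continuous g -> continuous h ->
  \int[(lebesgue_measure \x lebesgue_measure)%E]_(x in `[a, b] `*` `[c, d])
    (g x.1 * h x.2) =
  \int[mu]_(s in `[a, b]) g s * \int[mu]_(s in `[c, d]) h s.
Proof.
move=> cg ch.
have int (f : R -> R) (u v : R) : continuous f ->
  mu.-integrable `[u, v] (EFin \o f).
  by move=> cf; apply: continuous_itv_integrable => z _; exact: cf.
have [||||||-> _] := @Rintegral_fubini _ _
  (measurableTypeR R) (measurableTypeR R) R mu mu `[a, b]%classic `[c, d]%classic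
  (fun x => g x.1 * h x.2) (fun s => `|g s|) (fun s => `|h s|).
- by [].
- by [].
- apply: measurable_funM.
    by apply: measurableT_comp (measurable_fst); exact: continuous_measurable_fun.
  by apply: measurableT_comp (measurable_snd); exact: continuous_measurable_fun.
- exact: integrable_norm (int _ _ _ cg).
- exact: integrable_norm (int _ _ _ ch).
- by move=> x y _ _; rewrite normrM.
rewrite -RintegralZr//; last exact: int.
by apply: eq_Rintegral => s _; rewrite /= RintegralZl//; exact: int.
Qed.

(** The integrand splits into a function of the colatitude and one of the longitude. The factor i of
    [L2bar] turns cos - i sin into sin + i cos, and the sine part vanishes by oddness in z. *)
Lemma sphere_moment (Gamma t : R) i j : i != ord_max ->
  sphere_integral (fun p => exp_tL1 t (fun q =>
    dot (L2bar Gamma q) (delta_mx j 0)) p *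
     tensor (toC3 p) (toC3 p) i ord_max) =
  Complex 0 (3 * Gamma / 4 * profile t * (i == j)%:R).
Proof.
move=> i2; rewrite /sphere_integral /Cintegral.
(* The constant of [L2bar] without its factor i; the azimuthal moment contributes pi, which leaves 3
   Gamma / 4. *)
pose gam := 3 * Gamma / (4 * pi).
pose trig (g : R -> R) (a : R) := gam * (g (cos a * t) * weight (cos a) * sin a).
have integrandE (x : R * R) : (sin x.1)%:C%C * (exp_tL1 t (fun q =>
  dot (L2bar Gamma q) (delta_mx j 0)) (sphere_point x) *
     tensor (toC3 (sphere_point x)) (toC3 (sphere_point x)) i ord_max) =
  Complex (trig sin x.1 * (azimuth i x.2 * azimuth j x.2))
          (trig cos x.1 * (azimuth i x.2 * azimuth j x.2)).
  case: x => a b /=; rewrite /exp_tL1 Cexp_tL1 dot_L2bar.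
  rewrite /tensor !mxE big_ord1 !mxE /=.
  have -> : (if j == ord_max then 0
    else (nth 0 [:: sin a * cos b; sin a * sin b; cos a] j)%:C%C) =
    (sin a * azimuth j b)%:C%C.
    by case: j => [[|[|[|//]]] Hj] //=; rewrite /azimuth/= mulr0.
  have -> : nth 0 [:: sin a * cos b; sin a * sin b; cos a] i = sin a * azimuth i b.
    by case: i i2 => [[|[|[|//]]] Hi].
  rewrite /trig /gam /weight (mulrC t).
  have -> : 1 - cos a ^+ 2 = sin a ^+ 2 by rewrite -(cos2Dsin2 a) addrC addKr.
  have -> : 3 * 'i%C * Gamma%:C%C / (4 * pi%:C%C) =
    Complex 0 (3 * Gamma / (4 * pi)) :> C.
    have -> : 4 * pi%:C%C = (4 * pi)%:C%C :> C by rewrite rmorphM rmorph_nat.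
    rewrite -fmorphV -(rmorph_nat (real_complex R) 3).
    by apply/eqP; rewrite eq_complex /=; apply/andP; split; apply/eqP; ring.
  by apply/eqP; rewrite eq_complex /=; apply/andP; split; apply/eqP; ring.
have ca : continuous (fun b => azimuth i b * azimuth j b).
  by rewrite /azimuth; clear; case: i => [[|[|[|//]]] Hi];
    case: j => [[|[|[|//]]] Hj] /=; cont.
have cG (g : R -> R) : continuous g -> continuous (fun z : R =>
  g (z * t) * weight z).
  move=> cg z; apply: cvgM; last exact: weight_continuous.
  apply: (@cvg_comp _ _ _ (fun z : R => z * t) g _ (nbhs (z * t))); last exact: cg.
  by apply: cvgM; [exact: cvg_id|exact: cvg_cst].
have ct (g : R -> R) : continuous g -> continuous (trig g).
  move=> cg a; apply: cvgM; first exact: cvg_cst.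
  apply: cvgM; last exact: continuous_sin.
  by apply: (@continuous_comp _ _ _ cos (fun z => g (z * t) * weight z));
    [exact: continuous_cos|exact: cG].
have E (g : R -> R) : continuous g -> \int[mu]_(a in `[0, pi]) trig g a =
  gam * \int[mu]_(z in `[- 1, 1]) (g (z * t) * weight z).
  move=> cg; rewrite Rintegral_cos_subst; last exact: cG.
  rewrite -RintegralZl//; apply: continuous_itv_integrable => a _.
  have cgs : continuous (fun a => g (cos a * t) * weight (cos a) * sin a).
    move=> {}a; apply: cvgM; last exact: continuous_sin.
    by apply: (@continuous_comp _ _ _ cos (fun z => g (z * t) * weight z));
      [exact: continuous_cos|exact: cG].
  exact: cgs.
have P (g : R -> R) : continuous g ->
  \int[(lebesgue_measure \x lebesgue_measure)%E]_(x in `[0, pi] `*` `[0, 2 * pi])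
    (trig g x.1 * (azimuth i x.2 * azimuth j x.2)) =
  gam * \int[mu]_(z in `[- 1, 1]) (g (z * t) * weight z) * ((i == j)%:R * pi).
  by move=> cg; rewrite -E// -azimuth_moment//; exact: Rintegral_prod (ct _ cg) ca.
congr Complex.
  transitivity (gam *
    \int[mu]_(z in `[- 1, 1]) (sin (z * t) * weight z) * ((i == j)%:R * pi)).
    rewrite -P; last exact: continuous_sin.
    by apply: eq_Rintegral => x _; rewrite integrandE.
  by rewrite profile_sin mulr0 mul0r.
transitivity (gam *
    \int[mu]_(z in `[- 1, 1]) (cos (z * t) * weight z) * ((i == j)%:R * pi)).
  rewrite -P; last exact: continuous_cos.
  by apply: eq_Rintegral => x _; rewrite integrandE.
have p0 : pi != 0 :> R by rewrite gt_eqF ?pi_gt0.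
by rewrite /profile /gam; move: (pi : R) p0 => q q0; field.
Qed.

(** The factor i of [u_of] meets the purely imaginary moment, and the sign of [kernel_op] cancels
    i^2: the kernel is real and diagonal, with a zero last row. *)
Lemma kernelE (eps Gamma t : R) i j : Defs.kernel eps Gamma t i j =
  if i == ord_max then 0
  else (3 * eps * Gamma / 4 * (i == j)%:R * profile t)%:C%C.
Proof.
rewrite mxE /kernel_op mxE /u_of mxE -mulmxA proj_mulE mul_evec /sigma !mxE.
case: ifPn => [_|i2]; first by rewrite mulr0 oppr0.
rewrite sphere_moment//.
by apply/eqP; rewrite eq_complex /=; apply/andP; split; apply/eqP; field.
Qed.

Lemma laplace_kernelE (eps Gamma : R) (l : C) i j : 0 <= complex.Re l ->
  laplace (Defs.kernel eps Gamma) l i j =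
  if i == ord_max then 0 else (3 * eps * Gamma / 4 * (i == j)%:R)%:C%C * lap l.
Proof.
move=> l0; rewrite mxE.
pose c := 3 * eps * Gamma / 4 * (i == j)%:R.
have intc : mu.-integrable `[0, +oo[ (EFin \o (fun s =>
  expR (- (complex.Re l * s)) * cos (complex.Im l * s) * profile s)).
  apply: (@bounded_profile_integrable _ (fun s =>
    expR (- (complex.Re l * s)) * cos (complex.Im l * s))); first by cont.
  by move=> s s0; apply: expR_trig_le1 => //; exact: cos_max.
have ints : mu.-integrable `[0, +oo[ (EFin \o (fun s =>
  expR (- (complex.Re l * s)) * sin (complex.Im l * s) * profile s)).
  apply: (@bounded_profile_integrable _ (fun s =>
    expR (- (complex.Re l * s)) * sin (complex.Im l * s))); first by cont.
  by move=> s s0; apply: expR_trig_le1 => //; exact: sin_max.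
transitivity (Complex
  (\int[mu]_(s in `[0, +oo[) ((if i == ord_max then 0 else c) * (expR (- (complex.Re l * s)) * cos
  (complex.Im l * s) * profile s)))
  (\int[mu]_(s in `[0, +oo[) ((if i == ord_max then 0 else - c) * (expR (-
    (complex.Re l * s)) * sin (complex.Im l * s) * profile s)))).
  rewrite /Cintegral; congr Complex; apply: eq_Rintegral => s _;
    rewrite kernelE /Cexp; case: ifP => _; rewrite ?mulr0 ?mul0r//;
    case: l {l0 intc ints} => x y /=;
      rewrite !mulr0 ?oppr0 ?addr0 ?subr0 ?add0r !mulNr ?cosN ?sinN /c; ring.
rewrite !RintegralZl//; case: ifP => _; first by rewrite !mul0r.
rewrite /lap /lap_re /lap_im -/c.
by apply/eqP; rewrite eq_complex /=; apply/andP; split; apply/eqP; ring.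
Qed.

Lemma det_laplace_kernel (eps Gamma : R) (l : C) : 0 <= complex.Re l ->
  \det (1%:M + laplace (Defs.kernel eps Gamma) l) =
  (1 + (3 * eps * Gamma / 4)%:C%C * lap l) ^+ 2.
Proof.
move=> l0; set d := 1 + _.
have -> : 1%:M + laplace (Defs.kernel eps Gamma) l =
    diag_mx (\row_(i < 3) if i == ord_max then 1 else d).
  apply/matrixP => i j; rewrite [LHS]mxE laplace_kernelE// !mxE /d.
  case: eqVneq => [_|_]; last by rewrite mulr0 !mulr0n mul0r add0r; case: ifP.
  by rewrite mulr1 mulr1n; case: ifP => _ //; rewrite addr0.
rewrite det_diag !big_ord_recl big_ord0 !mxE /=; ring.
Qed.

End Kernel.

(** * The spectral condition *)

Section SpectralCondition.
Context {R : realType}.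
Local Notation C := R[i].
Local Notation normc := (@normc R).
Local Notation H := (@holder_const R).
Implicit Types (x y s X Y D : R) (l : C).

Let M : R := pi * weight (b_c R).

Lemma critical_value_gt0 : 0 < M.
Proof.
have [/andP[b0 b1] _ _] := @b_c_spec R.
by rewrite mulr_gt0 ?pi_gt0// mulr_gt0 ?exprn_gt0//; nra.
Qed.

Lemma normc_lap x y s : normc (lap (Complex x y) - s%:C%C) =
  Num.sqrt ((lap_re x y - s) ^+ 2 + lap_im x y ^+ 2).
Proof. by rewrite /= subr0. Qed.

Lemma lap_dist_continuous s :
  continuous (fun p : R * R => normc (lap (Complex `|p.1| p.2) - s%:C%C)).
Proof.
move=> p; under eq_fun do rewrite normc_lap.
apply: (@cvg_comp _ _ _ (fun p : R * R =>
  (lap_re `|p.1| p.2 - s) ^+ 2 + lap_im `|p.1| p.2 ^+ 2) (@Num.sqrt R));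
  last exact: sqrt_continuous.
apply: cvgD; apply: cvgM; try exact: lap_im_continuous;
  by apply: cvgB; [exact: lap_re_continuous|exact: cvg_cst].
Qed.

Lemma lap_bound_Re l X : 0 < X -> X <= complex.Re l -> normc (lap l) <= 4 / X.
Proof.
move=> X0 Xl; apply: lap_bound => //; first exact: lt_le_trans Xl.
by move=> z _; exact: le_trans Xl (pole_ge _ _).
Qed.

(** As |z| <= 1, the imaginary part y + z of the denominator has modulus at least |y| - 1 >= Y. The
    case x = 0 is a limit. *)
Lemma lap_bound_Im x y Y : 0 <= x -> 0 < Y -> Y + 1 <= `|y| ->
  normc (lap (Complex x y)) <= 4 / Y.
Proof.
move=> + Y0 Yy; have bd t : 0 < t -> normc (lap (Complex t y)) <= 4 / Y.
  move=> t0; apply: lap_bound => // z; rewrite in_itv/= => /andP[z1 z2].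
  apply: (@le_trans _ _ `|complex.Im (pole (Complex t y) z)|);
    last exact: normc_ge_Im.
  rewrite Im_pole [complex.Im _]/=.
  apply: (@le_trans _ _ (`|y| - `|z|));
    last by rewrite lerBlDr -{1}[y](addrK z) ler_normB.
  by have : `|z| <= 1 by [rewrite ler_norml z1]; lra.
rewrite le_eqVlt => /predU1P[<-|/bd//].
have h : normc (lap (Complex `|t| y) - 0%:C%C) @[t --> (0 :
  R)^'+] --> normc (lap (Complex `|0 : R| y) - 0%:C%C).
  apply: cvg_at_right_filter.
  apply: (@cvg_comp _ _ _ (fun t : R => (t, y)) (fun p : R * R =>
    normc (lap (Complex `|p.1| p.2) - 0%:C%C)) _ (nbhs ((0 : R), y))).
    by apply: (@cvg_pair _ _ _ _ (nbhs (0 : R)) (nbhs y));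
      [exact: cvg_id|exact: cvg_cst].
  exact: (@lap_dist_continuous 0 (0, y)).
rewrite normr0 subr0 in h; apply: (cvgr_to_le h); near=> t.
by rewrite subr0 ger0_norm//; exact: bd.
Unshelve. all: by end_near. Qed.

Lemma lap_boundary_real y s : 0 < s -> lap (Complex 0 y) = s%:C%C -> s = M.
Proof.
move=> s0 [hre him].
have [b01 hb uniq] := @b_c_spec R.
wlog y0 : y hre him / 0 <= y => [hw|].
  case: (lerP 0 y) => [|/ltW yN]; first exact: hw.
  by apply: (hw (- y)); rewrite ?lap_reN ?lap_imN ?him ?oppr0 ?oppr_ge0.
have [y1|y1] := lerP 1 y; first by have := lap_im_boundary_ge1 y1; rewrite him ltxx.
have y11 : - 1 < y < 1 by apply/andP; split; lra.
move: hre; rewrite lap_re_boundary// => hs.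
(* At y = 0 the value is 0, since w 0 = 0, against s > 0. *)
move: y0; rewrite le_eqVlt => /predU1P[y0|y0].
  by move: hs; rewrite -y0 /weight expr0n/= mul0r mulr0 => hs;
    rewrite -hs ltxx in s0.
suff yb : y = b_c R by rewrite -hs /M yb.
apply: uniq; first by rewrite y0.
by move: him; rewrite lap_im_boundary// => /eqP; rewrite oppr_eq0 => /eqP.
Qed.

Lemma lap_b_c : lap (Complex 0 (b_c R)) = M%:C%C.
Proof.
have [/andP[b0 b1] hb _] := @b_c_spec R.
have b11 : - 1 < b_c R < 1 by apply/andP; split; lra.
by rewrite /lap /= lap_re_boundary// lap_im_boundary// hb oppr0.
Qed.

Definition attained s := exists2 l : C, 0 < complex.Re l & lap l = s%:C%C.

Lemma attained_near s D : 0 < D -> D < s ->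
  (forall y, D <= normc (lap (Complex 0 y) - s%:C%C)) ->
  (exists2 l, 0 < complex.Re l & normc (lap l - s%:C%C) < D) -> attained s.
Proof.
move=> D0 Ds hD [[x0 y0] /= x00 hl]; apply: contrapT => ns.
have sD : 0 < s - D by rewrite subr_gt0.
(* On the right and horizontal sides of this rectangle |L| <= s - D, so that |L - s| >= D there; the
   left side is the hypothesis on the imaginary axis. *)
pose X := x0 + 4 / (s - D); pose Y := `|y0| + (4 / (s - D) + 1).
have q0 : 0 < 4 / (s - D) by rewrite divr_gt0.
have far l : normc (lap l) <= s - D -> D <= normc (lap l - s%:C%C).
  move=> ll; rewrite -normc_opp opprB; apply: le_trans (normcB_ge _ _).
  by rewrite normc_real gtr0_norm; lra.
have qE : 4 / (4 / (s - D)) = s - D by field; rewrite gt_eqF.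
have : D <= normc (lap (Complex x0 y0) - s%:C%C); last by rewrite leNgt hl.
apply: (@minimum_modulus R (fun l => lap l - s%:C%C) X Y D) => //.
- by rewrite /X addr_gt0.
- by rewrite /Y ltr_wpDl// addr_gt0.
- exact: lap_dist_continuous.
- move=> l /lap_taylor2[a [b [c T]]]; exists (a - s%:C%C), b, c.
  exact: taylor2_subC.
- move=> [x y] /=; rewrite le_eqVlt => /predU1P[<-|xp].
    by rewrite -normc_gt0; exact: lt_le_trans (hD y).
  by apply/eqP => /eqP; rewrite subr_eq0 => /eqP e; apply: ns; exists (Complex x y).
- move=> x y /andP[xx xX] /andP[yY yY'] /or3P[/eqP->//|/eqP->|/eqP yE].
    apply: far; rewrite -[leRHS]qE; apply: lap_bound_Re => //=.
    by rewrite /X lerDr ltW.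
  apply: far; rewrite -[leRHS]qE; apply: lap_bound_Im => //.
  by rewrite yE /Y lerDr.
- by rewrite ltW//= /X lerDl ltW.
- by rewrite -ler_norml /Y lerDl; lra.
Qed.

(** By compactness the distance is bounded below uniformly in s, which is what allows an interval to
    be crossed in finitely many steps. *)
Lemma lap_boundary_dist a b : 0 < a -> a <= b -> (forall s, a <= s <= b ->
  s != M) ->
  exists D, [/\ 0 < D, D < a &
    forall s y, a <= s <= b -> D <= normc (lap (Complex 0 y) - s%:C%C)].
Proof.
move=> a0 ab hM.
(* For |y| > Y, |L (i y)| <= 4 / (8 / a) = a / 2, at distance at least a / 2 from every s >= a. *)
pose Y := 8 / a + 1.
have q0 : 0 < 8 / a by rewrite divr_gt0.
pose f (p : R * R) := normc (lap (Complex 0 p.2) - p.1%:C%C).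
have cf : continuous f.
  move=> p; rewrite /f; under eq_fun do rewrite normc_lap.
  apply: (@cvg_comp _ _ _ (fun p : R * R =>
    (lap_re 0 p.2 - p.1) ^+ 2 + lap_im 0 p.2 ^+ 2) (@Num.sqrt R));
    last exact: sqrt_continuous.
  have c0 (g : R -> R -> R) : continuous (fun p : R * R => g `|p.1| p.2) ->
      {for p, continuous (fun p : R * R => g 0 p.2)}.
    move=> cg; rewrite -(normr0 R).
    apply: (@cvg_comp _ _ _ (fun p : R * R => ((0 : R), p.2)) (fun p : R * R =>
      g `|p.1| p.2) _ (nbhs ((0 : R), p.2))).
      by apply: (@cvg_pair _ _ _ _ (nbhs (0 : R)) (nbhs p.2));
        [exact: cvg_cst|exact: cvg_snd].
    exact: (cg (0, p.2)).
  have c1 := c0 _ lap_re_continuous; have c2 := c0 _ lap_im_continuous.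
  by apply: cvgD; apply: cvgM => //; apply: cvgB => //; exact: cvg_fst.
have Y0 : 0 < Y by rewrite /Y addr_gt0.
pose K : set (R * R) := `[a, b]%classic `*` `[- Y, Y]%classic.
have [[s0 y0] /set_mem[/= s0ab _] fmin] : exists2 c, c \in K & forall t,
  t \in K -> f c <= f t.
  apply: compact_EVT_min.
  - by exists (a, 0); split; rewrite /= in_itv/= ?lexx ?ab// oppr_le0 ltW.
  - by apply: compact_setX; exact: segment_compact.
  - exact: continuous_subspaceT.
have fpos : 0 < f (s0, y0).
  move: s0ab; rewrite /= in_itv/= => s0ab.
  rewrite /f normc_gt0 subr_eq0 /=; apply/eqP => e.
  have s00 : 0 < s0 by case/andP: s0ab => h _; exact: lt_le_trans h.
  by have := hM _ s0ab; rewrite (lap_boundary_real s00 e) eqxx.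
exists (Num.min (f (s0, y0)) (a / 2)); split.
- by rewrite lt_min fpos divr_gt0.
- by rewrite gt_min; apply/orP; right; lra.
move=> s y sab; rewrite ge_min.
have [yY|yY] := lerP `|y| Y.
  apply/orP; left; apply: (fmin (s, y)); apply/mem_set; split; rewrite /= in_itv//=.
  by rewrite -ler_norml.
apply/orP; right.
have h := @lap_bound_Im 0 y (8 / a) (lexx 0) q0 (ltW yY).
have sa : a <= s by case/andP: sab.
rewrite -[leRHS]/(normc (lap (Complex 0 y) - s%:C%C)) -normc_opp opprB.
apply: le_trans (normcB_ge _ _).
have e : 4 / (8 / a) = a / 2 by field; rewrite gt_eqF.
by rewrite e in h; rewrite normc_real gtr0_norm; lra.
Qed.

(** Walks from s to s' in equal steps shorter than the uniform distance D; each step is an instance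
    of [attained_near]. *)
Lemma attained_itv a b s s' : 0 < a -> (forall s, a <= s <= b -> s != M) ->
  a <= s <= b -> a <= s' <= b -> attained s -> attained s'.
Proof.
move=> a0 hM sab s'ab.
have ab : a <= b by case/andP: sab => h1 h2; exact: le_trans h1 h2.
have [D [D0 Da hD]] := lap_boundary_dist a0 ab hM.
have step u v : a <= u <= b -> a <= v <= b -> `|u - v| < D -> attained u ->
  attained v.
  move=> uab vab uv [l l0 lu]; apply: (@attained_near v D) => //.
  - by apply: lt_le_trans Da _; case/andP: vab.
  - by move=> y; exact: hD.
  - by exists l => //; rewrite lu -rmorphB normc_real.
have [n hn] : exists n : nat, `|s - s'| < n.+1%:R * D.
  exists (Num.bound (`|s - s'| / D)); rewrite -ltr_pdivrMr//.
  apply: lt_trans (archi_boundP _) _; first by rewrite divr_ge0// ltW.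
  by rewrite ltr_nat.
elim: n s sab hn => [|n ih] s sab; first by rewrite mul1r; exact: step.
move=> hn sA.
have n1 : 0 < n.+2%:R :> R by rewrite ltr0n.
(* One step covers the fraction 1 / (n + 2) of the way to s', hence less than D; the distance left
   is less than (n + 1) D. *)
pose c : R := n.+1%:R / n.+2%:R.
have nn : n.+2%:R = n.+1%:R + 1 :> R by rewrite -natr1.
have c0 : 0 <= c by rewrite divr_ge0// ?ler0n.
have c1 : c <= 1 by rewrite ler_pdivrMr// mul1r nn lerDl.
have cn : c * n.+2%:R = n.+1%:R by rewrite divfK// gt_eqF.
have c' : (1 - c) * n.+2%:R = 1 by rewrite mulrBl cn mul1r nn addrC addKr.
apply: (ih (s' + c * (s - s'))).
- by move: sab s'ab => /andP[? ?] /andP[? ?]; apply/andP; split; nra.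
- have -> : s' + c * (s - s') - s' = c * (s - s') by ring.
  by rewrite normrM (ger0_norm c0) -cn -mulrA ltr_pM2l// divr_gt0 ?ltr0n.
- apply: step sA => //.
    by move: sab s'ab => /andP[? ?] /andP[? ?]; apply/andP; split; nra.
  have -> : s - (s' + c * (s - s')) = (1 - c) * (s - s') by ring.
  rewrite normrM ger0_norm ?subr_ge0// -(ltr_pM2l n1) mulrA (mulrC _ (1 - c)) c'
    mul1r//.
Qed.

Lemma attained_small e : 0 < e -> exists2 s, 0 < s < e & attained s.
Proof.
move=> e0; pose x := 4 / e + 1.
have q0 : 0 < 4 / e by rewrite divr_gt0.
have x0 : 0 < x by rewrite addr_gt0.
have im0 : lap_im x 0 = 0.
  by have := @lap_imN R x 0 (ltW x0); rewrite oppr0; lra.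
have lE : lap (Complex x 0) = (lap_re x 0)%:C%C by rewrite /lap /= im0.
exists (lap_re x 0); last by exists (Complex x 0).
apply/andP; split; last first.
  have := @lap_bound_Re (Complex x 0) x x0 (lexx _).
  rewrite lE normc_real => h; apply: le_lt_trans (ler_norm _) _.
  by apply: le_lt_trans h _; rewrite ltr_pdivrMr// mulrDr mulr1 mulrCA divff
    ?gt_eqF//; lra.
have d0 : 0 < x ^+ 2 + 1 by rewrite ltr_wpDl// sqr_ge0.
apply: (@lt_le_trans _ _ (4 / 15 * x / (x ^+ 2 + 1))).
  by rewrite divr_gt0// mulr_gt0.
rewrite lap_reE//.
have -> : 4 / 15 * x / (x ^+ 2 + 1) =
    \int[lebesgue_measure]_(z in `[- 1, 1]) (weight z * (x / (x ^+ 2 + 1))).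
  rewrite (Rintegral_FTC (F := fun z =>
    (z ^+ 3 / 3 - z ^+ 5 / 5) * (x / (x ^+ 2 + 1)))).
  - by field; rewrite gt_eqF.
  - lra.
  - by move=> z _; move: z; rewrite /weight; cont.
  - by move=> z _; rewrite /weight; derive; rewrite /=; field; rewrite gt_eqF.
apply: le_Rintegral => //.
- by apply: itv11_integrable; rewrite /weight; cont.
- apply: itv11_integrable; rewrite /weight => z; eapply D_continuous; derive_rule.
  by rewrite gt_eqF// sqr_sum_gt0.
move=> z z1; apply: ler_wpM2l; first exact: weight_ge0.
apply: ler_wpM2l; first exact: ltW.
rewrite lef_pV2 ?posrE ?sqr_sum_gt0// lerD2l add0r.
by move: z1; rewrite /= in_itv/= => /andP[? ?]; nra.
Qed.

Lemma attained_bound s : attained s -> s <= H.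
Proof.
case=> l l0 /(congr1 (@complex.Re R)) /= <-.
exact: le_trans (ler_norm _) (lap_re_bound _ (ltW l0)).
Qed.

Lemma attainedP s : 0 < s -> s != M -> attained s <-> s < M.
Proof.
move=> s0 sM; have M0 := critical_value_gt0; split=> [sA|ltsM].
  rewrite ltNge; apply/negP => leMs.
  have ltMs : M < s by rewrite lt_neqAle eq_sym sM.
  have H0 := @holder_const_ge0 R.
  suff /attained_bound : attained (s + H + 1) by lra.
  apply: (@attained_itv s (s + H + 1) s) => //.
  - by move=> u /andP[su _]; rewrite gt_eqF//; exact: lt_le_trans su.
  - by apply/andP; split; lra.
  - by apply/andP; split; lra.
have [u /andP[u0 us] uA] := attained_small s0.
apply: (@attained_itv u s u) => //.
- by move=> v /andP[_ vs]; rewrite lt_eqF//; exact: le_lt_trans ltsM.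
- by rewrite lexx ltW.
- by rewrite lexx ltW.
Qed.

Lemma spectral_conditionE (eps Gamma : R) : spectral_condition eps Gamma <->
  forall l, 0 <= complex.Re l -> 1 + (3 * eps * Gamma / 4)%:C%C * lap l != 0.
Proof.
split=> h l l0; have := h l l0; rewrite det_laplace_kernel// expf_eq0//.
Qed.

Lemma Gamma_cE : Gamma_c R = (3 / 4 * M)^-1.
Proof. by rewrite /Gamma_c /M /weight; congr (_^-1); ring. Qed.

End SpectralCondition.

Theorem proposition3p4 (R : realType) (eps Gamma : R)
    (heps : eps = 1 \/ eps = - 1) (hGamma : 0 <= Gamma) :
  (eps = 1 -> spectral_condition eps Gamma) /\
  (eps = - 1 -> (spectral_condition eps Gamma <-> Gamma < Gamma_c R)).
Proof.
have M0 := @critical_value_gt0 R; have GE := @Gamma_cE R.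
have aP := @attainedP R.
have bR y s := @lap_boundary_real R y s.
have bc := @lap_b_c R.
set M := pi * weight (b_c R) in M0 GE aP bR bc.
have bM : 0 < 3 / 4 * M by rewrite mulr_gt0.
split=> [->|->]; first apply/spectral_conditionE => l l0.
  apply/eqP => /(congr1 (@complex.Re R)).
  rewrite ReD ReM /= mul0r subr0 mulr1.
  have := lap_re_ge0 (complex.Im l) l0; nra.
split=> [/spectral_conditionE h|hG].
  rewrite ltNge; apply/negP; rewrite GE => GcG.
  have G0 : 0 < Gamma by apply: lt_le_trans GcG; rewrite invr_gt0.
  pose s := 4 / (3 * Gamma).
  have s0 : 0 < s by rewrite divr_gt0// mulr_gt0.
  have sM : s <= M.
    have h1 : 1 <= Gamma * (3 / 4 * M) by rewrite -ler_pdivrMr// mul1r.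
    by rewrite /s ler_pdivrMr ?mulr_gt0//; lra.
  have [l l0 ls] : exists2 l, 0 <= complex.Re l & lap l = s%:C%C.
    have [->|sneM] := eqVneq s M; first by exists (Complex 0 (b_c R)).
    have [l l0 ls] : attained s by apply/aP => //; rewrite lt_neqAle sneM.
    by exists l => //; exact: ltW.
  have := h l l0; rewrite ls -rmorphM -(rmorph1 (real_complex R)) -rmorphD.
  have -> : 1 + 3 * -1 * Gamma / 4 * s = 0 by rewrite /s; field; rewrite gt_eqF.
  by rewrite eqxx.
apply/spectral_conditionE => l l0; apply/eqP => e.
have G0 : 0 < Gamma.
  rewrite lt0r hGamma andbT; apply/eqP => g0; move: e.
  rewrite g0 mulr0 mul0r mul0r addr0 => /eqP; by rewrite oner_eq0.
pose s := 4 / (3 * Gamma).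
have s0 : 0 < s by rewrite divr_gt0// mulr_gt0.
have sM : M < s.
  have h1 : Gamma * (3 / 4 * M) < 1 by rewrite -ltr_pdivlMr// mul1r -GE.
  by rewrite /s ltr_pdivlMr ?mulr_gt0//; lra.
have ls : lap l = s%:C%C.
  have c0 : (3 * -1 * Gamma / 4)%:C%C != 0 :> R[i].
    by rewrite fmorph_eq0 lt_eqF//; lra.
  apply: (mulfI c0); apply: (addrI 1);
    rewrite e -rmorphM -(rmorph1 (real_complex R)) -rmorphD.
  have -> : 1 + 3 * -1 * Gamma / 4 * s = 0 by rewrite /s; field; rewrite gt_eqF.
  by rewrite rmorph0.
have sneM : s != M by rewrite gt_eqF.
move: l0; rewrite le_eqVlt => /predU1P[l0|l0].
  move: ls; case: l {e} l0 => x y /= <- /(bR _ _ s0) sE.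
  by rewrite sE eqxx in sneM.
have /(aP _ s0 sneM) : attained s by exists l.
by rewrite ltNge ltW.
Qed.
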